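(* Let $X$ be a Banach space and let $\{Y_\xi\}_{\xi\le\alpha}$ be a family of closed subspaces of $X$, indexed by the ordinals $0\le\xi\le\alpha$, satisfying the $(\ast)$-condition, such that $Y_{\xi_1}\subset Y_{\xi_2}$ whenever $\xi_1<\xi_2\le\alpha$, $Y_0=\{0\}$, $Y_\alpha=X$, and $Y_\xi=\overline{\bigcup_{\zeta<\xi}Y_\zeta}$ for each limit ordinal $\xi\le\alpha$. If $\alpha<\omega^{1+\beta}$ and $Sz(Y_{\xi+1}/Y_\xi)\le\omega^\gamma$ for each $0\le\xi<\alpha$, then $Sz(X)\le\omega^{\gamma+\beta}$.
   Context: A family $\{Y_i\}_{i\in I}$ of closed subspaces of a Banach space $X$ satisfies the $(\ast)$-condition if there is a family $\{P_i\}_{i\in I}$ of linear projections on $X^\ast$ with $\ker P_i=Y_i^\perp$, $\|P_i\|\le 1$, and such that for every $\varepsilon>0$ there is $\delta(\varepsilon)>0$ with $\|\varphi-P_i\varphi\|<\varepsilon$ for every $i\in I$ whenever $\|\varphi\|=1$ and $\|\varphi+P_i\varphi\|>2-\delta(\varepsilon)$. Szlenk index: for weak*-compact $K\subset X^\ast$ and $\varepsilon>0$, $s_\varepsilon(K)=\{x^\ast\in K:\ \text{every weak*-neighborhood } V \text{ of } x^\ast \text{ has } \mathrm{diam}(V\cap K)>\varepsilon\}$; iterate transfinitely (intersections at limits); $Sz_\varepsilon(K)=\min\{\alpha:s^\alpha_\varepsilon(K)=\emptyset\}$ or $\infty$; $Sz(K)=\sup_\varepsilon Sz_\varepsilon(K)$;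 $Sz(X)=Sz(B_{X^\ast})$. Ordinal arithmetic is used. *)

(* Defs.v *)
From HB Require Import structures.
From mathcomp Require Import all_boot all_order all_algebra.
From mathcomp Require Import all_classical all_reals all_analysis.
Set Implicit Arguments. Unset Strict Implicit. Unset Printing Implicit Defensive.
Import Order.TTheory GRing.Theory Num.Theory.
Import numFieldNormedType.Exports.
Local Open Scope classical_set_scope.
Local Open Scope ring_scope.

(* Ordinals, represented as (generalised) Brouwer trees.              *)
(*   OZ = 0,  OS a = a + 1,  OL I f = sup_{i : I} f i                 *)
(* Ordinal equality is  ole a b /\ ole b a  (trees are not canonical). *)
Inductive Ord : Type :=
| OZ : Ord
| OS : Ord -> Ord
| OL : forall (I : Type), (I -> Ord) -> Ord.

Inductive ole : Ord -> Ord -> Prop :=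
| ole_Z b : ole OZ b
| ole_S a b : ole a b -> ole (OS a) (OS b)
| ole_Sr a b : ole a b -> ole a (OS b)
| ole_Ll (I : Type) (f : I -> Ord) b : (forall i, ole (f i) b) -> ole (OL f) b
| ole_Lr a (I : Type) (f : I -> Ord) (i : I) : ole a (f i) -> ole a (OL f).

Definition olt (a b : Ord) : Prop := ole (OS a) b.

Definition olimit (a : Ord) : Prop := olt OZ a /\ forall z, olt z a -> olt (OS z) a.

Definition oone : Ord := OS OZ.

(* ordinal addition (the None branch handles empty sups) *)
Fixpoint oadd (a b : Ord) : Ord :=
  match b with
  | OZ => a
  | OS b' => OS (oadd a b')
  | @OL J f => @OL (option J) (fun o => match o with None => a | Some i => oadd a (f i) end)
  end.

Fixpoint omul (a b : Ord) : Ord :=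
  match b with
  | OZ => OZ
  | OS b' => oadd (omul a b') a
  | @OL J f => @OL J (fun i => omul a (f i))
  end.

Definition ofin (n : nat) : Ord := iter n OS OZ.
Definition oomega : Ord := @OL nat ofin.

Fixpoint wpow (b : Ord) : Ord :=
  match b with
  | OZ => oone
  | OS b' => omul (wpow b') oomega
  | @OL J f => @OL (option J) (fun o => match o with None => oone | Some i => wpow (f i) end)
  end.

Section Banach.
Variables (R : realType) (X : normedModType R).

Definition is_dual (phi : X -> R) : Prop :=
  (forall (a : R) (x y : X), phi (a *: x + y) = a * phi x + phi y) /\ continuous phi.

Definition dnorm (phi : X -> R) : R :=
  sup [set `|phi x| | x in [set x : X | `|x| <= 1]].

Definition dual_ball : set (X -> R) := [set phi | is_dual phi /\ dnorm phi <= 1].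

Definition closed_subspace (Y : set X) : Prop :=
  Y 0 /\ (forall (a : R) (x y : X), Y x -> Y y -> Y (a *: x + y)) /\ closed Y.

Definition annih (Y : set X) : set (X -> R) :=
  [set phi | is_dual phi /\ forall y, Y y -> phi y = 0].

Definition star_condition (I : Type) (J : set I) (Y : I -> set X) : Prop :=
  exists P : I -> (X -> R) -> (X -> R),
    (forall i, J i ->
       (forall phi, is_dual phi -> is_dual (P i phi)) /\
       (forall (a : R) phi psi, is_dual phi -> is_dual psi ->
            P i (fun x => a * phi x + psi x) = (fun x => a * P i phi x + P i psi x)) /\
       (forall phi, is_dual phi -> P i (P i phi) = P i phi) /\
       (forall phi, is_dual phi -> (P i phi = (fun _ => 0) <-> annih (Y i) phi)) /\
       (forall phi, is_dual phi -> dnorm (P i phi) <= dnorm phi)) /\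
    (forall eps : R, 0 < eps -> exists delta : R, 0 < delta /\
       forall i, J i -> forall phi, is_dual phi -> dnorm phi = 1 ->
         2 - delta < dnorm (fun x => phi x + P i phi x) ->
         dnorm (fun x => phi x - P i phi x) < eps).

(* Szlenk derivation. The dual ball is a set K of functionals; the
   weak*-topology is the one of pointwise convergence on the set S of
   points of the underlying space; nrm is the dual norm.  A basic
   weak*-neighbourhood of x is determined by a finite F ⊆ S and eta > 0. *)
Definition wnbhd (F : set X) (eta : R) (x : X -> R) : set (X -> R) :=
  [set y | forall p, F p -> `|y p - x p| < eta].

Definition sz_deriv (S : set X) (nrm : (X -> R) -> R) (eps : R)
    (K : set (X -> R)) : set (X -> R) :=
  [set x | K x /\ forall (F : set X) (eta : R), finite_set F -> F `<=` S -> 0 < eta ->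
     exists a b, K a /\ K b /\ wnbhd F eta x a /\ wnbhd F eta x b /\
       eps < nrm (fun t => a t - b t)].

Fixpoint sz_iter (S : set X) (nrm : (X -> R) -> R) (eps : R)
    (K : set (X -> R)) (a : Ord) : set (X -> R) :=
  match a with
  | OZ => K
  | OS b => sz_deriv S nrm eps (sz_iter S nrm eps K b)
  | @OL J f => [set x | K x /\ forall i, sz_iter S nrm eps K (f i) x]
  end.

Definition szlenk_le (S : set X) (nrm : (X -> R) -> R) (K : set (X -> R))
    (delta : Ord) : Prop :=
  forall eps : R, 0 < eps -> sz_iter S nrm eps K delta = set0.

Definition Sz_le (delta : Ord) : Prop := szlenk_le setT dnorm dual_ball delta.

Definition qnorm (Y0 : set X) (y : X) : R := inf [set `|y - z| | z in Y0].

(* closed unit ball of (Y1/Y0)^*: functionals on Y1 that are linear,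
   vanish on Y0 (so factor through the quotient), are bounded by the
   quotient norm; canonically extended by 0 outside Y1. *)
Definition quot_dual_ball (Y1 Y0 : set X) : set (X -> R) :=
  [set psi | (forall (a : R) y z, Y1 y -> Y1 z -> psi (a *: y + z) = a * psi y + psi z) /\
             (forall z, Y0 z -> psi z = 0) /\
             (forall x, ~ Y1 x -> psi x = 0) /\
             (forall y, Y1 y -> `|psi y| <= qnorm Y0 y)].

Definition quot_dnorm (Y1 Y0 : set X) (psi : X -> R) : R :=
  sup [set `|psi y| | y in [set y | Y1 y /\ qnorm Y0 y <= 1]].

Definition Sz_quot_le (Y1 Y0 : set X) (delta : Ord) : Prop :=
  szlenk_le Y1 (quot_dnorm Y1 Y0) (quot_dual_ball Y1 Y0) delta.

End Banach.

(* Main.v *)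
(** Idea.  For [xi <= eta] write [Sz(xi, eta)] for the Szlenk index of [Y eta / Y xi], computed
    inside the dual of [X] on the functionals vanishing on [Y xi], with the norm of restrictions
    to [Y eta].  By Hahn-Banach [P eta phi] has the norm of the restriction of [phi] to [Y eta],
    and the star condition says that [phi] is close to [P eta phi] once that restriction almost
    attains the norm of [phi].

    Two steps: if [Sz(xi, eta)] and [Sz(eta, zeta)] are at most [w^mu], so is [Sz(xi, zeta)].
    Slice the ball by the norm of the restriction to [Y eta] into finitely many geometric
    layers.  Inside a layer [P eta] is almost weak*-continuous, so a functional may be replaced
    by the pair [(P eta phi, phi - P eta phi)], for which indecomposability of [w^mu] separates
    the two coordinates; if [w^mu > 1], compactness yields an index whose finite multiples stay
    below [w^mu], which leaves room for all the layers.

    Limit: if [Y eta] is the closure of the union of the [Y zeta] and [Sz(xi, zeta) <= w^mu] for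
    all [xi <= zeta < eta], then [w^mu] derivations shrink the norm on [Y eta] by a fixed factor,
    so [Sz(xi, eta) <= w^(mu+1)].

    Induction on [beta] then gives [Sz(xi, eta) <= w^(gamma+beta)] for [eta < xi + w^(1+beta)]. *)
Require Import Defs.
From HB Require Import structures.
From mathcomp Require Import all_boot all_order all_algebra.
From mathcomp Require Import all_classical all_reals all_analysis.
From mathcomp Require Import finmap ring lra.
Set Implicit Arguments. Unset Strict Implicit. Unset Printing Implicit Defensive.
Import Order.TTheory GRing.Theory Num.Theory.
Import numFieldNormedType.Exports.
Local Open Scope classical_set_scope.
Local Open Scope ring_scope.


(** * Order and arithmetic of tree ordinals *)

Lemma ole_refl a : ole a a.
Proof.
elim: a => [|a IH|I f IH]; first exact: ole_Z.
- exact: ole_S.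
- by apply: ole_Ll => i; apply: ole_Lr (IH i).
Qed.

(** The match on [a] replaces inversion at [OL], which would produce equations between dependent
    pairs. *)
Lemma ole_inv_left a b : ole a b ->
  match a with
  | OZ => True
  | OS a' => ole a' b
  | OL J f => forall i, ole (f i) b
  end.
Proof.
elim=> {a b} [//|a b ab _|a b ab|I f b fb _ //|a I f i ai].
- exact: ole_Sr.
- by case: a ab => [//|a|I f] ab IH; [exact: ole_Sr|move=> i; exact: ole_Sr].
- by case: a ai => [//|a|J g] ai IH; [exact: ole_Lr IH|move=> j; exact: ole_Lr (IH j)].
Qed.

Lemma ole_inv_succ a b : ole (OS a) b ->
  match b with
  | OZ => False
  | OS b' => ole a b'
  | OL J f => exists i, ole (OS a) (f i)
  end.
Proof.
suff gen c : ole c b ->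
    match c, b with
    | OS _, OZ => False
    | OS c', OS b' => ole c' b'
    | OS _, OL J f => exists i, ole c (f i)
    | _, _ => True
    end by move=> /gen.
case=> {c b} [//|//|c b cb|//|c J f i ci].
- by case: c cb => // c; exact: (@ole_inv_left (OS c)).
- by case: c ci => // c ci; exists i.
Qed.

Lemma ole_trans b a c : ole a b -> ole b c -> ole a c.
Proof.
move=> ab; elim: ab c => {a b} [b c _|a b _ IH c|a b _ IH c bc|I f b _ IH c bc|a I f i _ IH c fc].
- exact: ole_Z.
- elim: c => [/ole_inv_succ //|c _ /ole_inv_succ bc|J g IHg /ole_inv_succ[j bj]].
  + exact/ole_S/IH.
  + exact: ole_Lr (IHg j bj).
- exact/IH/(@ole_inv_left (OS b)).
- by apply: ole_Ll => i; exact: IH.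
- exact/IH/(@ole_inv_left (OL f)).
Qed.

(** Structural induction with excluded middle: at a supremum, either one branch already exceeds the
    other side or every branch stays below it. *)
Lemma ole_total a b : ole a b \/ ole (OS b) a.
Proof.
elim: a b => [|a IHa|I f IHf] b; first by left; exact: ole_Z.
- elim: b => [|b _|J g IHg].
  + by right; apply: ole_S; exact: ole_Z.
  + by case: (IHa b) => h; [left|right]; exact: ole_S.
  + have [[j h]|h] := pselect (exists j, ole (OS a) (g j)).
      by left; exact: ole_Lr h.
    right; apply/ole_S/ole_Ll => j; case: (IHg j) => [ag|/ole_inv_succ //].
    by exfalso; apply: h; exists j.
- have [[i h]|h] := pselect (exists i, ole (OS b) (f i)).
    by right; exact: ole_Lr h.
  left; apply: ole_Ll => i; case: (IHf i b) => // fb.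
  by exfalso; apply: h; exists i.
Qed.

Lemma ole_oaddr a b : ole a (oadd a b).
Proof.
elim: b => [|b IH|J f IH] /=; first exact: ole_refl.
- exact: ole_Sr.
- by apply: (@ole_Lr _ _ _ None); exact: ole_refl.
Qed.

Lemma ole_oadd2l a b c : ole b c -> ole (oadd a b) (oadd a c).
Proof.
elim=> {b c} [c|b c _ IH|b c _ IH|J f c _ IH|b J f i _ IH] /=.
- exact: ole_oaddr.
- exact: ole_S.
- exact: ole_Sr.
- by apply: ole_Ll => -[i|]; [exact: IH|exact: ole_oaddr].
- exact: (@ole_Lr _ _ _ (Some i)).
Qed.

Lemma ole_oadd0 b : ole b (oadd OZ b).
Proof.
elim: b => [|b IH|J f IH] /=; first exact: ole_Z.
- exact: ole_S.
- by apply: ole_Ll => i; exact: (@ole_Lr _ _ _ (Some i)).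
Qed.

Lemma ole_omul_omega a n : ole (omul a (ofin n)) (omul a oomega).
Proof. by apply: (@ole_Lr _ _ _ n); exact: ole_refl. Qed.

Lemma ole_wpow_succ a : ole (wpow a) (wpow (OS a)).
Proof. exact: ole_trans (ole_oadd0 _) (ole_omul_omega _ 1). Qed.

Lemma oone_le_wpow a : ole oone (wpow a).
Proof.
elim: a => [|a IH|J f IH]; first exact: ole_refl.
- exact: ole_trans IH (ole_wpow_succ a).
- by apply: (@ole_Lr _ _ _ None); exact: ole_refl.
Qed.

Lemma ole_wpow_oaddr a b : ole (wpow a) (wpow (oadd a b)).
Proof.
elim: b => [|b IH|J f IH]; first exact: ole_refl.
- exact: ole_trans IH (ole_wpow_succ _).
- by apply: (@ole_Lr _ _ _ (Some None)); exact: ole_refl.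
Qed.

Lemma ole_ofin_omul a n : ole oone a -> ole (ofin n) (omul a (ofin n)).
Proof.
move=> a1; elim: n => [|n IH]; first exact: ole_Z.
exact: ole_trans (ole_S IH) (ole_oadd2l _ a1).
Qed.

(** A tree can denote zero without being [OZ], so the exponent zero is recognised by the size of the
    power. *)
Lemma wpow_finite_or_infinite a : ole (wpow a) oone \/ ole oomega (wpow a).
Proof.
elim: a => [|a _|J f IH]; first by left; exact: ole_refl.
- right; apply: ole_Ll => n.
  exact: ole_trans (ole_ofin_omul n (oone_le_wpow a)) (ole_omul_omega _ n).
- have [[i h]|h] := pselect (exists i, ole oomega (wpow (f i))).
    by right; exact: (@ole_Lr _ _ _ (Some i)).
  left; apply: ole_Ll => -[i|]; last exact: ole_refl.
  by case: (IH i) => // fi; exfalso; apply: h; exists i.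
Qed.

Lemma omul_oone_ofin n : omul oone (ofin n) = ofin n.
Proof. by elim: n => //= n ->. Qed.

(** * Transfinite iteration of a set operator *)

(** Generic form of [sz_iter], shared by all the derivations below. The clause [K x] at [OL] covers
    suprema over an empty type. *)
Fixpoint diter (T : Type) (D : set T -> set T) (K : set T) (a : Ord) : set T :=
  match a with
  | OZ => K
  | OS b => D (diter D K b)
  | OL J f => [set x | K x /\ forall i, diter D K (f i) x]
  end.

Lemma sz_iter_diter (R : realType) (X : normedModType R) (S : set X) nrm (eps : R) K a :
  sz_iter S nrm eps K a = diter (sz_deriv S nrm eps) K a.
Proof.
elim: a => [//|a /= -> //|J f IH] /=; rewrite predeqE => x; split=> -[Kx h]; split=> // i.
  by rewrite -IH.
by rewrite IH.
Qed.

Section Derivation.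
Variables (T : Type) (D : set T -> set T).
Hypothesis Dle : forall K, D K `<=` K.
Hypothesis Dmono : forall K L, K `<=` L -> D K `<=` D L.

Lemma diter_sub K a : diter D K a `<=` K.
Proof.
by elim: a => [//|a IH|J f _] x /=; [move=> /Dle/IH|case].
Qed.

Lemma diter_mono K L a : K `<=` L -> diter D K a `<=` diter D L a.
Proof.
move=> KL; elim: a => [//|a IH|J f IH] /=; first exact: Dmono.
by move=> x [/KL Lx h]; split=> // i; apply: IH.
Qed.

Lemma diter_anti K a b : ole a b -> diter D K b `<=` diter D K a.
Proof.
elim=> {a b} [b|a b _ IH|a b _ IH|J f b _ IH|a J f i _ IH] /=.
- exact: diter_sub.
- exact: Dmono.
- by move=> x /Dle/IH.
- move=> x bx; split=> [|i]; first exact: diter_sub bx.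
  exact: IH.
- by move=> x [_ h]; exact: IH.
Qed.

Lemma diter_add K a b : diter D K (oadd a b) = diter D (diter D K a) b.
Proof.
elim: b => [//|b /= -> //|J f IH] /=; rewrite predeqE => x; split.
- by move=> [Kx h]; split=> [|i]; [exact: h None|rewrite -IH; exact: h (Some i)].
- move=> [ax h]; split=> [|[i|//]]; first exact: diter_sub ax.
  by rewrite IH.
Qed.

Lemma diter_mul_ofin K a n :
  diter D K (omul a (ofin n)) = iter n (fun L => diter D L a) K.
Proof. by elim: n => //= n IH; rewrite diter_add IH. Qed.

Lemma iter_diter_anti K a m n : (m <= n)%N ->
  iter n (fun L => diter D L a) K `<=` iter m (fun L => diter D L a) K.
Proof.
move=> /subnK <-; elim: (n - m)%N => [//|k IH] x.
by rewrite addSn iterS => /diter_sub; exact: IH.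
Qed.

Lemma iter_diter_mono K L a n : K `<=` L ->
  iter n (fun L => diter D L a) K `<=` iter n (fun L => diter D L a) L.
Proof. by move=> KL; elim: n => //= n IH; exact: diter_mono. Qed.

End Derivation.

(** Branches are comparable. If [P] fails at [g i], it fails at every larger branch, where [Q] must
    hold; smaller branches inherit [Q] from [g i]. *)
Lemma ole_chain_or (P Q : Ord -> Prop) (I : Type) (g : I -> Ord) :
  (forall a b, ole a b -> P b -> P a) -> (forall a b, ole a b -> Q b -> Q a) ->
  (forall i, P (g i) \/ Q (g i)) -> (forall i, P (g i)) \/ (forall i, Q (g i)).
Proof.
move=> Pm Qm PQ; have [hP|/existsNP[i nP]] := pselect (forall i, P (g i)); first by left.
right => j; case: (PQ j) => // Pj.
have [ij|/(@ole_inv_left (OS _)) ji] := ole_total (g i) (g j).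
  by exfalso; exact: nP (Pm _ _ ij Pj).
by case: (PQ i) => // /(Qm _ _ ji).
Qed.

(** * Derivations by a relation on a topological space *)

Section TopologicalDerivation.
Variable T : topologicalType.
Implicit Types (E : T -> T -> Prop) (K A B : set T).

Definition lderiv E K : set T :=
  [set x | K x /\ forall V, nbhs x V -> exists a, [/\ K a, V a & E x a]].

(* Unlike the Szlenk derivation, which uses pairs of points, this one
   commutes with finite unions of closed sets and with unions of relations. *)
Definition cderiv E K : set T := K `&` closure (lderiv E K).

Lemma cderiv_sub E K : cderiv E K `<=` K.
Proof. by move=> x []. Qed.

Lemma cderiv_mono E K L : K `<=` L -> cderiv E K `<=` cderiv E L.
Proof.
move=> KL x [/KL Lx clx]; split=> //; apply: closure_subset clx => y [/KL Ly h].
by split=> // V /h[a [/KL La Va Ea]]; exists a.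
Qed.

Lemma closed_diter_cderiv E K a : closed K -> closed (diter (cderiv E) K a).
Proof.
move=> Kc; elim: a => [//|a IH|J f IH] /=.
  by apply: closedI => //; exact: closed_closure.
rewrite (_ : [set x | _] = K `&` \bigcap_(i in [set: J]) diter (cderiv E) K (f i)).
  by apply: closedI => //; apply: closed_bigI => i _.
by rewrite predeqE => x; split=> -[Kx h]; split=> // i *; exact: h.
Qed.

Lemma lderivU E A B : closed A -> closed B ->
  lderiv E (A `|` B) `<=` lderiv E A `|` lderiv E B.
Proof.
move=> Ac Bc x [_ xAB].
(* A neighbourhood of [x] free of related points of [K]: by closedness if [x] is outside [K], by
   failure of [lderiv] otherwise. *)
have far K : closed K -> ~ lderiv E K x ->
    exists2 V, nbhs x V & forall a, K a -> V a -> ~ E x a.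
  move=> Kc nK; have [Kx|nKx] := pselect (K x); last first.
    exists (~` K) => [|a Ka /(_ Ka) //].
    by apply: open_nbhs_nbhs; split => //; exact: closed_openC.
  have /existsNP[V /not_implyP[Vx nV]] :
      ~ forall V, nbhs x V -> exists a, [/\ K a, V a & E x a].
    by move=> h; apply: nK.
  by exists V => // a Ka Va Ea; apply: nV; exists a.
have [xA|/(far _ Ac)[V Vx hV]] := pselect (lderiv E A x); first by left.
have [xB|/(far _ Bc)[W Wx hW]] := pselect (lderiv E B x); first by right.
by have [a [[Aa|Ba] [Va Wa] Ea]] := xAB _ (filterI Vx Wx); exfalso;
  [exact: hV Ea|exact: hW Ea].
Qed.

Lemma cderivU E A B : closed A -> closed B ->
  cderiv E (A `|` B) `<=` cderiv E A `|` cderiv E B.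
Proof.
move=> Ac Bc x [_ /(closure_subset (lderivU Ac Bc))].
rewrite closureU => -[clx|clx]; [left|right]; split=> //.
- by apply: Ac; apply: closure_subset clx => y [].
- by apply: Bc; apply: closure_subset clx => y [].
Qed.

Lemma cderiv_relU E1 E2 K :
  cderiv (fun x y => E1 x y \/ E2 x y) K `<=` cderiv E1 K `|` cderiv E2 K.
Proof.
move=> x [Kx clx]; rewrite /cderiv -setIUr -closureU; split=> //.
apply: closure_subset clx => y [Ky h].
have [y1|n1] := pselect (lderiv E1 K y); first by left.
right; split=> // V Vy.
have /existsNP[W /not_implyP[Wy nW]] :
    ~ forall V, nbhs y V -> exists a, [/\ K a, V a & E1 y a].
  by move=> h1; apply: n1.
have [a [Ka [Va Wa] [E1a|E2a]]] := h _ (filterI Vy Wy); last by exists a.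
by exfalso; apply: nW; exists a.
Qed.

Lemma diter_cderivU E A B a : closed A -> closed B ->
  diter (cderiv E) (A `|` B) a `<=` diter (cderiv E) A a `|` diter (cderiv E) B a.
Proof.
move=> Ac Bc; elim: a => [//|a IH|J f IH] x /=.
  by move=> /(cderiv_mono IH) /cderivU; apply; exact: closed_diter_cderiv.
move=> [ABx h].
(* The extra index, sent to [OZ], carries the membership clause of [diter] at a supremum. *)
pose g (o : option J) := if o is Some i then f i else OZ.
case: (@ole_chain_or (fun u => diter (cderiv E) A u x)
    (fun u => diter (cderiv E) B u x) _ g) => [u v uv|u v uv|o|hA|hB].
- exact: diter_anti (@cderiv_sub E) (@cderiv_mono E) _ _ _ uv _.
- exact: diter_anti (@cderiv_sub E) (@cderiv_mono E) _ _ _ uv _.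
- by case: o => [i|//]; exact/IH/h.
- by left; split=> [|i]; [exact: hA None|exact: hA (Some i)].
- by right; split=> [|i]; [exact: hB None|exact: hB (Some i)].
Qed.

(* Indecomposability of [wpow c] enters through the successor step: among the
   m-fold compositions of two operators, each word has many occurrences of one of them. *)
Lemma diter_cderiv_relU E1 E2 K c : closed K ->
  diter (cderiv (fun x y => E1 x y \/ E2 x y)) K (wpow c) `<=`
  diter (cderiv E1) K (wpow c) `|` diter (cderiv E2) K (wpow c).
Proof.
set E := fun x y => _.
have le1 := @cderiv_sub E1; have le2 := @cderiv_sub E2; have le := @cderiv_sub E.
have mo1 := @cderiv_mono E1; have mo2 := @cderiv_mono E2; have mo := @cderiv_mono E.
elim: c K => [|c IH|J f IH] K Kc.
- exact: cderiv_relU.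
- pose w := wpow c.
  (* One block of [w] steps for [E] lands in the union of a block for [E1] and a block for [E2];
     [diter_cderivU] then distributes the remaining blocks over the two sets. *)
  have words m L : closed L -> forall x,
      iter m (fun L => diter (cderiv E) L w) L x -> exists p q, [/\ (p + q = m)%N,
      iter p (fun L => diter (cderiv E1) L w) L x &
      iter q (fun L => diter (cderiv E2) L w) L x].
    elim: m L => [|m IHm] L Lc x; first by exists 0%N, 0%N.
    have Lc1 := closed_diter_cderiv (E := E1) (a := w) Lc.
    have Lc2 := closed_diter_cderiv (E := E2) (a := w) Lc.
    rewrite iterSr -diter_mul_ofin // => /(diter_mono mo (IH _ Lc)).
    move=> /diter_cderivU-/(_ Lc1 Lc2); rewrite !diter_mul_ofin //.
    case=> /IHm[//|p [q [<- xp xq]]].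
    + exists p.+1, q; split=> //; first by rewrite iterSr.
      by apply: iter_diter_mono xq => //; exact: diter_sub.
    + exists p, q.+1; split=> //; first by rewrite addnS.
        by apply: iter_diter_mono xp => //; exact: diter_sub.
      by rewrite iterSr.
  move=> x /= [Kx h]; apply: contrapT => /not_orP[n1 n2].
  have ex E' : ~ (K x /\ forall n, diter (cderiv E') K (omul w (ofin n)) x) ->
      exists n, ~ diter (cderiv E') K (omul w (ofin n)) x.
    by move=> n'; apply/existsNP => h'; apply: n'.
  have [[n {}n1] [m {}n2]] := (ex _ n1, ex _ n2).
  (* A word of length [n + m] has at least [n] letters of the first kind or at least [m] of the
     second. *)
  have := h (n + m)%N; rewrite diter_mul_ofin // => /words-/(_ Kc)[p [q [pq xp xq]]].
  have [np|pn] := leqP n p.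
    by apply: n1; rewrite diter_mul_ofin //; apply: iter_diter_anti np _ xp.
  apply: n2; rewrite diter_mul_ofin //; apply: iter_diter_anti _ _ xq => //.
  by rewrite -(leq_add2l p) pq leq_add2r ltnW.
- move=> x /= [Kx h].
  pose g (o : option J) := if o is Some i then wpow (f i) else oone.
  case: (@ole_chain_or (fun u => diter (cderiv E1) K u x)
      (fun u => diter (cderiv E2) K u x) _ g) => [u v uv|u v uv|o|h1|h2].
  + exact: diter_anti le1 mo1 _ _ _ uv _.
  + exact: diter_anti le2 mo2 _ _ _ uv _.
  + case: o => [i|]; first by apply: IH => //; exact: h (Some i).
    by have /cderiv_relU := h None.
  + by left.
  + by right.
Qed.

(** Comparability of the branches makes the closed sets [C (g i)] nested, so they generate a proper
    filter, and a cluster point lies in all of them. *)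
Lemma compact_ole_chain K (C : Ord -> set T) (I : Type) (g : I -> Ord) :
  compact K -> (forall a, closed (C a)) -> (forall a, C a `<=` K) ->
  (forall a b, ole a b -> C b `<=` C a) -> I ->
  (forall i, C (g i) !=set0) -> exists x, K x /\ forall i, C (g i) x.
Proof.
move=> Kk Cc CK Cm i0 C0.
have FF : ProperFilter (filter_from [set: I] (fun i => C (g i))).
  apply: filter_from_proper => [|i _]; last exact: C0.
  apply: filter_from_filter => [|i j _ _]; first by exists i0.
  have [ij|/(@ole_inv_left (OS _)) ji] := ole_total (g i) (g j).
    by exists j => // y Cy; split=> //; exact: Cm Cy.
  by exists i => // y Cy; split=> //; exact: Cm Cy.
have [|x [Kx clx]] := Kk _ FF; first by exists i0 => //; exact: CK.
exists x; split=> // i; apply: Cc => V Vx; apply: clx => //.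
by exists i.
Qed.

(** By compactness, emptiness at a supremum already occurs at a branch. At a successor exponent the
    branch is a finite multiple of the previous power, all of whose finite multiples stay below
    [wpow c]; at a supremum of exponents one descends to a branch. *)
Lemma diter_cderiv_wpow_eq0 E K c : compact K -> closed K ->
  diter (cderiv E) K (wpow c) = set0 ->
  ole (wpow c) oone \/ exists b n,
    diter (cderiv E) K (omul (wpow b) (ofin n)) = set0 /\
    forall m, ole (omul (wpow b) (ofin m)) (wpow c).
Proof.
move=> Kk Kc.
have chain (J : Type) (f : J -> Ord) : diter (cderiv E) K (OL f) = set0 -> J ->
    exists i, diter (cderiv E) K (f i) = set0.
  move=> h j; apply: contrapT => /forallNP h0.
  have [x [_ hx]] := @compact_ole_chain K _ J f Kk
    (fun a => closed_diter_cderiv (a := a) Kc)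
    (fun a => diter_sub (@cderiv_sub E) (a := a))
    (fun a b => diter_anti (@cderiv_sub E) (@cderiv_mono E) (K := K) (a := a) (b := b))
    j (fun i => proj1 (set0P _) (introN eqP (h0 i))).
  by have : (set0 : set T) x by rewrite -h; split=> //; exact: diter_sub (@cderiv_sub E) _ _ _ (hx j).
elim: c => [_|b _ h|J f IH h]; first by left; exact: ole_refl.
- right; have [n n0] := chain _ _ h 0%N; exists b, n; split=> // m.
  exact: ole_omul_omega.
- have [le1|lew] := wpow_finite_or_infinite (OL f); [by left|right].
  have fin1 : diter (cderiv E) K oone = set0 -> exists b n,
      diter (cderiv E) K (omul (wpow b) (ofin n)) = set0 /\
      forall m, ole (omul (wpow b) (ofin m)) (wpow (OL f)).
    move=> h1; exists OZ, 1%N; split=> // m; rewrite omul_oone_ofin.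
    by apply: ole_trans lew; apply: (@ole_Lr _ _ _ m); exact: ole_refl.
  have [[i|] hi] := chain _ _ h None; last exact: fin1.
  (* If the chosen branch has value one, a single derivation is enough, and finite ordinals stay
     below the infinite [wpow (OL f)]. *)
  have [fi|[b [n [bn hb]]]] := IH i hi.
    apply: fin1; apply/seteqP; split=> // x; rewrite -hi.
    exact: diter_anti (@cderiv_sub E) (@cderiv_mono E) _ _ _ fi _.
  exists b, n; split=> // m; apply: ole_trans (hb m) _.
  by apply: (@ole_Lr _ _ _ (Some i)); exact: ole_refl.
Qed.

End TopologicalDerivation.

(** * Bounded functionals, Hahn-Banach and the dual norm *)

Section Functionals.
Variables (R : realType) (X : normedModType R).
Implicit Types (phi psi : X -> R) (S : set X) (r : R).

Definition linear_on S phi : Prop :=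
  forall (a : R) x y, S x -> S y -> phi (a *: x + y) = a * phi x + phi y.

Definition bounded_on S r phi : Prop := forall x, S x -> `|phi x| <= r * `|x|.

Section HahnBanach.
Variables (r : R) (r0 : 0 <= r).
Implicit Types G : set (X * R).

(** [G] is read as the graph of a partial linear functional; domination by [r * |x|] forces it to be
    single-valued. *)
Let good G : Prop :=
  (forall (a : R) p q, G p -> G q -> G (a *: p.1 + q.1, a * p.2 + q.2)) /\
  (forall p, G p -> p.2 <= r * `|p.1|).

Let good_fun G x t u : good G -> G (x, t) -> G (x, u) -> t = u.
Proof.
move=> [Gl Gb] Gt Gu.
have le v w : G (x, v) -> G (x, w) -> v <= w.
  move=> Gv Gw; have /Gb := Gl (-1) _ _ Gw Gv.
  by rewrite /= scaleN1r addNr normr0 mulr0; lra.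
by apply/eqP; rewrite eq_le !le.
Qed.

(** One-dimensional extension. The value at [x] must lie between all [p.2 - r * |p.1 - x|] and all
    [r * |q.1 + x| - q.2]; the triangle inequality separates the two families, and the supremum [c]
    of the first is chosen. *)
Let good_extend G x : good G -> G (0, 0) ->
  exists2 H, good H & G `<=` H /\ exists t, H (x, t).
Proof.
move=> [Gl Gb] G0.
pose A := [set p.2 - r * `|p.1 - x| | p in G].
have sep p q : G p -> G q -> p.2 - r * `|p.1 - x| <= r * `|q.1 + x| - q.2.
  move=> Gp Gq; have := Gb _ (Gl 1 _ _ Gp Gq); rewrite /= scale1r mul1r.
  have : `|p.1 + q.1| <= `|p.1 - x| + `|q.1 + x|.
    by apply: le_trans (ler_normD _ _); rewrite [x in `|x| <= _](_ : _ = p.1 - x + (q.1 + x)) // addrACA addNr addr0.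
  move=> /(ler_wpM2l r0); rewrite mulrDr; lra.
have A0 : A !=set0 by exists (0 - r * `|0 - x|); exists (0, 0).
pose c := sup A.
have cl p : G p -> p.2 - r * `|p.1 - x| <= c.
  move=> Gp; apply: ub_le_sup; last by exists p.
  by exists (r * `|0 + x| - 0) => _ [q Gq <-]; exact: (@sep q (0, 0)).
have cr q : G q -> c <= r * `|q.1 + x| - q.2.
  by move=> Gq; apply: ge_sup => // _ [p Gp <-]; exact: sep.
exists [set h | exists p a, G p /\ h = (p.1 + a *: x, p.2 + a * c)]; last first.
  split; last by exists c, (0, 0), 1; rewrite scale1r mul1r !add0r.
  by case=> y t Gyt; exists (y, t), 0; rewrite scale0r mul0r !addr0.
split=> [b _ _ [p [a [Gp ->]]] [q [a' [Gq ->]]]|_ [p [a [Gp ->]]]] /=.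
  exists (b *: p.1 + q.1, b * p.2 + q.2), (b * a + a'); split; first exact: Gl.
  by congr pair => /=; [rewrite scalerDr addrACA scalerA scalerDl|ring].
have Gs (b : R) : G (b *: p.1, b * p.2) by have := Gl b _ _ Gp G0; rewrite /= !addr0.
(* For nonzero [a], rescaling [p] by the inverse of [|a|] reduces domination to [cl] or [cr],
   according to the sign. *)
have [a0|a0|->] := ltgtP a 0; last by rewrite scale0r mul0r !addr0; exact: Gb.
- have := cl _ (Gs (- a^-1)); rewrite /=.
  have -> : - a^-1 *: p.1 - x = - a^-1 *: (p.1 + a *: x).
    by rewrite scalerDr scalerA mulNr mulVf ?lt_eqF// scaleN1r.
  rewrite normrZ gtr0_norm ?oppr_gt0 ?invr_lt0// => h.
  have na : 0 <= - a by lra.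
  have := ler_wpM2l na h.
  have -> : - a * (- a^-1 * p.2 - r * (- a^-1 * `|p.1 + a *: x|)) = p.2 - r * `|p.1 + a *: x|.
    by field; rewrite lt_eqF.
  lra.
- have := cr _ (Gs a^-1); rewrite /=.
  have -> : a^-1 *: p.1 + x = a^-1 *: (p.1 + a *: x).
    by rewrite scalerDr scalerA mulVf ?gt_eqF// scale1r.
  rewrite normrZ gtr0_norm ?invr_gt0// => h.
  have := ler_wpM2l (ltW a0) h.
  have -> : a * (r * (a^-1 * `|p.1 + a *: x|) - a^-1 * p.2) = r * `|p.1 + a *: x| - p.2.
    by field; rewrite gt_eqF.
  lra.
Qed.

Lemma hahn_banach S phi :
  S 0 -> (forall (a : R) x y, S x -> S y -> S (a *: x + y)) ->
  linear_on S phi -> bounded_on S r phi ->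
  exists psi, [/\ linear_on setT psi, bounded_on setT r psi &
                  forall x, S x -> psi x = phi x].
Proof.
move=> S0 Sl phil phib.
pose G0 := [set h : X * R | S h.1 /\ h.2 = phi h.1].
have G0g : good G0.
  split=> [a p q [Sp ep] [Sq eq]|p [Sp ->]]; last exact: le_trans (ler_norm _) (phib _ Sp).
  by split=> /=; [exact: Sl|rewrite ep eq phil].
have phi0 : phi 0 = 0 by have := phil 1 0 0 S0 S0; rewrite scaler0 addr0; lra.
(* Joining [G0] inside the predicate lets the empty chain pass, while the maximal graph still
   extends [phi]. *)
have [F FP tot|A [Ag Amax]] := @Zorn_bigcup _ [set G | good (G0 `|` G)].
  split=> [a p q Gp Gq|p [G0p|[G FG Gp]]]; last 2 first.
  - exact: G0g.2.
  - by apply: (FP _ FG).2; right.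
  have up G u : F G -> (G0 `|` G) u -> (G0 `|` \bigcup_(X in F) X) u.
    by move=> FG [|Gu]; [left|right; exists G].
  case: Gp Gq => [Gp|[G FG Gp]] [Gq|[H FH Hq]].
  - by left; exact: G0g.1.
  - by apply: (up H) => //; apply: (FP _ FH).1; [left|right].
  - by apply: (up G) => //; apply: (FP _ FG).1; [right|left].
  - have [GH|HG] := tot _ _ FG FH.
      by apply: (up H) => //; apply: (FP _ FH).1; right => //; exact: GH.
    by apply: (up G) => //; apply: (FP _ FG).1; right => //; exact: HG.
set G := G0 `|` A in Ag.
have Gtot x : exists t, G (x, t).
  have [|H Hg [GH [t Ht]]] := @good_extend G x Ag; first by left.
  exists t; apply: contrapT => nG; apply: (Amax H).
    split=> [h Ah|HA]; first by apply: GH; right.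
    by apply: nG; right; exact: HA.
  by rewrite /= setUidr // => h G0h; apply: GH; left.
have [psi Gpsi] := choice Gtot.
have psil : linear_on setT psi.
  move=> a x y _ _; apply: (good_fun Ag (Gpsi _)).
  exact: (Ag.1 a _ _ (Gpsi x) (Gpsi y)).
exists psi; split=> // [x _|x Sx]; last by apply: (good_fun Ag (Gpsi x)); left.
have psi0 : psi 0 = 0 by have := psil 1 0 0 I I; rewrite scaler0 addr0; lra.
rewrite ler_norml; apply/andP; split; last exact: (Ag.2 _ (Gpsi x)).
have := Ag.2 _ (Gpsi (- x)); rewrite /= normrN.
have -> : psi (- x) = - psi x by have := psil (-1) x 0 I I; rewrite scaleN1r addr0 psi0; lra.
lra.
Qed.

End HahnBanach.

Lemma linear_on0 S phi : S 0 -> linear_on S phi -> phi 0 = 0.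
Proof. by move=> S0 /(_ 1 0 0 S0 S0); rewrite scaler0 addr0; lra. Qed.

Lemma bounded_is_dual r phi : linear_on setT phi -> bounded_on setT r phi -> is_dual phi.
Proof.
move=> phil phib; split=> [a x y|x]; first exact: phil.
have phiB y z : phi (y - z) = phi y - phi z.
  by rewrite -scaleN1r addrC phil // addrC mulN1r.
apply/cvgrPdist_le => e e0.
have r1 : 0 < `|r| + 1 by rewrite ltr_wpDl.
near=> y; rewrite -phiB; apply: le_trans (phib _ I) _.
apply: (@le_trans _ _ ((`|r| + 1) * `|x - y|)).
  by apply: ler_wpM2r => //; have := ler_norm r; lra.
rewrite -ler_pdivlMl //; near: y.
by apply: cvgr_dist_le => //; rewrite mulr_gt0 ?invr_gt0.
Unshelve. all: by end_near.
Qed.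

Lemma is_dual_linear phi : is_dual phi -> linear_on setT phi.
Proof. by move=> [phil _] a x y _ _; exact: phil. Qed.

Lemma linearZ_on phi (a : R) x : linear_on setT phi -> phi (a *: x) = a * phi x.
Proof.
move=> phil; have := phil a x 0 I I; rewrite addr0.
by rewrite (linear_on0 _ phil) // addr0.
Qed.

Lemma linearB_on phi x y : linear_on setT phi -> phi (x - y) = phi x - phi y.
Proof. by move=> phil; rewrite -scaleN1r addrC phil // addrC mulN1r. Qed.

Lemma unit_ball_bounded S r phi : linear_on setT phi ->
  (forall (a : R) x, S x -> S (a *: x)) ->
  (forall x, S x -> `|x| <= 1 -> `|phi x| <= r) -> bounded_on S r phi.
Proof.
move=> phil SZ h x Sx; have [->|x0] := eqVneq x 0.
  by rewrite (linear_on0 _ phil) // !normr0 mulr0.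
have nx : 0 < `|x| by rewrite normr_gt0.
have := h _ (SZ `|x|^-1 _ Sx).
rewrite normrZ normfV normr_id mulVf ?gt_eqF// => /(_ (lexx _)).
by rewrite linearZ_on // normrM normfV normr_id ler_pdivrMl // mulrC.
Qed.

Lemma is_dual_bounded phi : is_dual phi -> exists2 r, 0 <= r & bounded_on setT r phi.
Proof.
move=> phid; have phil := is_dual_linear phid; have phi0 := linear_on0 (I : setT 0) phil.
have /cvgrPdist_le/(_ 1 ltr01) := phid.2 0.
rewrite phi0 => /nbhs_ballP[d /= d0 hd].
have d20 : 0 < d / 2 by lra.
exists (d / 2)^-1; first by rewrite invr_ge0 ltW.
apply: unit_ball_bounded => // x _ x1.
have := hd ((d / 2) *: x); rewrite -ball_normE /= sub0r normrN normrZ gtr0_norm //.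
rewrite sub0r normrN linearZ_on // normrM gtr0_norm // => h.
rewrite -[leRHS]mulr1 ler_pdivlMl //; apply: h.
by apply: (@le_lt_trans _ _ (d / 2 * 1)); [rewrite ler_pM2l|lra].
Qed.

(** Continuity of [phi] bounds the set whose supremum is [dnorm phi], so the norm can be traded for
    a pointwise estimate. *)
Lemma dnorm_leP phi r : is_dual phi -> 0 <= r ->
  (dnorm phi <= r) <-> bounded_on setT r phi.
Proof.
move=> phid r0; have phil := is_dual_linear phid; split=> h.
  apply: unit_ball_bounded => // x _ x1; apply: le_trans h.
  have [M M0 hM] := is_dual_bounded phid.
  apply: ub_le_sup; last by exists x.
  exists M => _ [y /= y1 <-]; apply: le_trans (hM _ I) _.
  by rewrite -[leRHS]mulr1 ler_wpM2l.
apply: ge_sup; first by exists `|phi 0|; exists 0 => //=; rewrite normr0.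
move=> _ [y /= y1 <-]; apply: le_trans (h _ I) _.
by rewrite -[leRHS]mulr1 ler_wpM2l.
Qed.

Lemma dnorm_ge0 phi : is_dual phi -> 0 <= dnorm phi.
Proof.
move=> phid; have [M M0 hM] := is_dual_bounded phid.
apply: le_trans (normr_ge0 (phi 0)) _; apply: ub_le_sup; last by exists 0 => //=; rewrite normr0.
exists M => _ [y /= y1 <-]; apply: le_trans (hM _ I) _.
by rewrite -[leRHS]mulr1 ler_wpM2l.
Qed.

Lemma dnorm_bounded phi : is_dual phi -> bounded_on setT (dnorm phi) phi.
Proof. by move=> phid; apply/dnorm_leP => //; exact: dnorm_ge0. Qed.

Lemma is_dual_comb (a : R) phi psi : is_dual phi -> is_dual psi ->
  is_dual (fun x => a * phi x + psi x).
Proof.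
move=> phid psid; have [r r0 hr] := is_dual_bounded phid.
have [s s0 hs] := is_dual_bounded psid.
apply: (@bounded_is_dual (`|a| * r + s)) => [b x y _ _|x _].
  by rewrite (is_dual_linear phid) // (is_dual_linear psid) //; ring.
apply: le_trans (ler_normD _ _) _; rewrite mulrDl lerD ?hs // normrM -mulrA.
by rewrite ler_wpM2l // hr.
Qed.

End Functionals.

(** * The projections of the star condition *)

Section StarProjections.
Variables (R : realType) (X : normedModType R) (Ix : Type) (J : set Ix).
Variables (Y : Ix -> set X) (P : Ix -> (X -> R) -> (X -> R)).
Implicit Types (phi psi : X -> R) (i j : Ix).
Hypothesis Ysub : forall i, J i -> closed_subspace (Y i).
Hypothesis Pstar : forall i, J i ->
  (forall phi, is_dual phi -> is_dual (P i phi)) /\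
  (forall (a : R) phi psi, is_dual phi -> is_dual psi ->
     P i (fun x => a * phi x + psi x) = (fun x => a * P i phi x + P i psi x)) /\
  (forall phi, is_dual phi -> P i (P i phi) = P i phi) /\
  (forall phi, is_dual phi -> (P i phi = (fun _ => 0) <-> annih (Y i) phi)) /\
  (forall phi, is_dual phi -> dnorm (P i phi) <= dnorm phi).
Hypothesis Pmodulus : forall eps : R, 0 < eps -> exists delta : R, 0 < delta /\
  forall i, J i -> forall phi, is_dual phi -> dnorm phi = 1 ->
    2 - delta < dnorm (fun x => phi x + P i phi x) ->
    dnorm (fun x => phi x - P i phi x) < eps.

Lemma proj_dual i phi : J i -> is_dual phi -> is_dual (P i phi).
Proof. by move=> /Pstar[h _]; exact: h. Qed.

Lemma proj_comb i (a : R) phi psi : J i -> is_dual phi -> is_dual psi ->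
  P i (fun x => a * phi x + psi x) = (fun x => a * P i phi x + P i psi x).
Proof. by move=> /Pstar[_ [h _]]; exact: h. Qed.

Lemma proj_sub i phi psi : J i -> is_dual phi -> is_dual psi ->
  P i (fun x => phi x - psi x) = (fun x => P i phi x - P i psi x).
Proof.
move=> Ji phid psid.
rewrite (_ : (fun x => phi x - psi x) = (fun x => (-1) * psi x + phi x)); last first.
  by apply: funext => x; ring.
by rewrite proj_comb //; apply: funext => x; ring.
Qed.

Lemma is_dual_sub phi psi : is_dual phi -> is_dual psi -> is_dual (fun x => phi x - psi x).
Proof.
move=> phid psid.
rewrite (_ : (fun x => _) = (fun x => (-1) * psi x + phi x)); last by apply: funext => x; ring.
exact: is_dual_comb.
Qed.

Lemma proj_eq i phi psi : J i -> is_dual phi -> is_dual psi ->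
  (forall y, Y i y -> phi y = psi y) -> P i phi = P i psi.
Proof.
move=> Ji phid psid e.
have d : is_dual (fun x => phi x - psi x) by exact: is_dual_sub.
have [_ [_ [_ [ker _]]]] := Pstar Ji.
have : P i (fun x => phi x - psi x) = (fun _ => 0).
  by apply/ker => //; split=> // y /e ->; rewrite subrr.
rewrite proj_sub // => h; apply: funext => x.
by have := congr1 (fun f => f x) h; lra.
Qed.

(** By idempotence [P i phi - phi] lies in the kernel of [P i], which is the annihilator of
    [Y i]. *)
Lemma proj_on i phi y : J i -> is_dual phi -> Y i y -> P i phi y = phi y.
Proof.
move=> Ji phid Yy; have [_ [_ [idem [ker _]]]] := Pstar Ji.
have d : is_dual (fun x => P i phi x - phi x) by apply: is_dual_sub => //; exact: proj_dual.
have [_ /(_ y Yy)] : annih (Y i) (fun x => P i phi x - phi x); last by lra.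
apply/ker => //; rewrite proj_sub //; last exact: proj_dual.
by rewrite idem //; apply: funext => x; rewrite subrr.
Qed.

Lemma proj_proj i j phi : J i -> J j -> Y i `<=` Y j -> is_dual phi ->
  P i (P j phi) = P i phi.
Proof.
move=> Ji Jj Yij phid; apply: proj_eq => //; first exact: proj_dual.
by move=> y /Yij Yy; exact: proj_on.
Qed.

(* By Hahn-Banach, [P i phi = P i psi] for a norm-preserving extension [psi]
   of the restriction of [phi]. *)
Lemma proj_bounded i phi (r : R) : J i -> 0 <= r -> is_dual phi ->
  bounded_on (Y i) r phi -> bounded_on setT r (P i phi).
Proof.
move=> Ji r0 phid phib; have [Y0 [Ycomb _]] := Ysub Ji.
have [|psi [psil psib epsi]] := hahn_banach r0 Y0 Ycomb _ phib.
  by move=> a x y _ _; exact: (is_dual_linear phid).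
have psid := bounded_is_dual psil psib.
rewrite (@proj_eq i phi psi) //; last by move=> y /epsi.
apply/dnorm_leP => //; first exact: proj_dual.
have [_ [_ [_ [_ nP]]]] := Pstar Ji.
by apply: le_trans (nP _ psid) _; apply/dnorm_leP.
Qed.

(** Homogeneous form of the star condition. At [y] in [Y i] the functional [phi + P i phi] takes the
    value [2 * phi y], so if [phi] nearly attains its bound at [y], the normalised functional meets
    the hypothesis of the modulus. *)
Lemma proj_modulus (eps : R) : 0 < eps -> exists2 d : R, 0 < d < 1 &
  forall i phi y r, J i -> is_dual phi -> 0 < r -> bounded_on setT r phi ->
    Y i y -> `|y| <= 1 -> (1 - d) * r <= `|phi y| ->
    bounded_on setT (eps * r) (fun x => phi x - P i phi x).
Proof.
move=> eps0; have [delta [delta0 hd]] := Pmodulus eps0.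
(* The first bound gives [2 * (1 - d) > 2 - delta], the second [d < 1]. *)
pose d := Num.min (delta / 4) (1 / 2).
have d0 : 0 < d by rewrite lt_min; apply/andP; split; lra.
have d4 : d <= delta / 4 by rewrite ge_min lexx.
have d2 : d <= 1 / 2 by rewrite ge_min lexx orbT.
exists d => [|i phi y r Ji phid r0 phib Yy y1 hy]; first by apply/andP; split; lra.
have phil := is_dual_linear phid.
set n := dnorm phi.
have nr : n <= r by apply/dnorm_leP => //; exact: ltW.
have nphi := dnorm_bounded phid; have n0 := dnorm_ge0 phid; rewrite -/n in nphi n0.
have phyn : `|phi y| <= n.
  by apply: le_trans (nphi y I) _; rewrite -[leRHS]mulr1 ler_wpM2l.
have ngt0 : 0 < n.
  by apply: lt_le_trans phyn; apply: lt_le_trans hy; apply: mulr_gt0 => //; lra.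
have ninv : 0 < n^-1 by rewrite invr_gt0.
have zd : is_dual (fun _ : X => 0 : R).
  by apply: (@bounded_is_dual _ _ 0) => [a x z _ _|x _]; rewrite ?mulr0 ?addr0 // normr0 mul0r.
(* The summand [0] puts the normalised functional in the form to which linearity of [P i]
   applies. *)
pose u := fun x => n^-1 * phi x + 0.
have ud : is_dual u by exact: is_dual_comb.
have Pu : P i u = fun x => n^-1 * P i phi x.
  rewrite /u (@proj_comb i n^-1 phi (fun _ => 0)) //.
  have [_ [_ [_ [ker _]]]] := Pstar Ji.
  have -> : P i (fun _ => 0) = (fun _ => 0) by apply/ker.
  by apply: funext => x; rewrite addr0.
have u1 : dnorm u = 1.
  apply/eqP; rewrite eq_le; apply/andP; split.
    apply/dnorm_leP => // x _; rewrite /u addr0 normrM gtr0_norm // mul1r.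
    by rewrite ler_pdivrMl //; exact: nphi.
  rewrite -(@ler_pM2l _ n) // mulr1 /n; apply/dnorm_leP => //.
    by apply: mulr_ge0 => //; exact: dnorm_ge0.
  move=> x _; have := dnorm_bounded ud (I : setT x).
  rewrite /u addr0 normrM gtr0_norm // -/u ler_pdivrMl // => h.
  by apply: le_trans h _; rewrite -mulrA.
have sumd : is_dual (fun x => u x + P i u x).
  rewrite (_ : (fun x => _) = (fun x => 1 * u x + P i u x)); last by apply: funext => x; ring.
  by apply: is_dual_comb => //; exact: proj_dual.
have difd : is_dual (fun x => u x - P i u x) by apply: is_dual_sub => //; exact: proj_dual.
have := hd i Ji u ud u1; have -> : 2 - delta < dnorm (fun x => u x + P i u x).
  have := dnorm_bounded sumd (I : setT y); rewrite proj_on //.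
  rewrite (_ : u y + u y = 2 * n^-1 * phi y); last by rewrite /u; ring.
  rewrite !normrM (gtr0_norm ninv) ger0_norm // => h.
  have h1 : 2 * n^-1 * `|phi y| <= dnorm (fun x => u x + P i u x).
    apply: le_trans h _; rewrite -[leRHS]mulr1 ler_wpM2l //; exact: dnorm_ge0.
  apply: lt_le_trans h1.
  have : 1 - d <= n^-1 * `|phi y|.
    rewrite ler_pdivlMl // mulrC; apply: le_trans hy.
    by apply: ler_wpM2l => //; lra.
  lra.
move=> /(_ isT)/ltW/dnorm_leP => /(_ difd (ltW eps0)) h x _.
have := h x I; rewrite Pu /u addr0 -mulrBr normrM gtr0_norm // ler_pdivrMl // => h'.
apply: le_trans h' _; rewrite mulrA; apply: ler_wpM2r => //.
by rewrite mulrC; apply: ler_wpM2l => //; exact: ltW.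
Qed.

End StarProjections.

(** * Weak*-derivations and their transport along maps *)

(** Iterates never leave [K], so the one-step comparison may assume [L] inside [K], where norm
    bounds are available. *)
Lemma diter_transfer (T U : Type) (D : set T -> set T) (D' : set U -> set U)
    (g : T -> U) K K' a :
  (forall L, D L `<=` L) ->
  (forall L L', L `<=` K -> (forall x, L x -> L' (g x)) -> forall x, D L x -> D' L' (g x)) ->
  (forall x, K x -> K' (g x)) ->
  forall x, diter D K a x -> diter D' K' a (g x).
Proof.
move=> Dle DD' KK'; elim: a => [//|a IH|J f IH] x /=.
  by apply: DD' => //; exact: diter_sub.
by move=> [/KK' Kx h]; split=> // i; exact: IH.
Qed.

Section WeakStarDerivation.
Variables (R : realType) (X : normedModType R).
Implicit Types (E : (X -> R) -> (X -> R) -> Prop) (K L V : set (X -> R)).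

(** For a subspace [S], the restriction of [a - b] to [S] has norm above [eps], expressed by a
    witness instead of a supremum. *)
Definition splits (S : set X) (eps : R) (a b : X -> R) : Prop :=
  exists y, [/\ S y, `|y| <= 1 & eps < `|a y - b y|].

Definition szd E K : set (X -> R) :=
  [set x | K x /\ forall F eta, finite_set F -> 0 < eta ->
     exists a b, [/\ K a, K b, wnbhd F eta x a, wnbhd F eta x b & E a b]].

Lemma szd_sub E K : szd E K `<=` K.
Proof. by move=> x []. Qed.

Lemma szd_mono E K L : K `<=` L -> szd E K `<=` szd E L.
Proof.
move=> KL x [/KL Lx h]; split=> // F eta Ff eta0.
by have [a [b [/KL La /KL Lb ha hb Eab]]] := h F eta Ff eta0; exists a, b.
Qed.

Lemma diter_szd_le E E' K K' a : K `<=` K' ->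
  (forall x y, K x -> K y -> E x y -> E' x y) ->
  diter (szd E) K a `<=` diter (szd E') K' a.
Proof.
move=> KK' EE'; apply: (diter_transfer (g := id)) => // [L|L L' LK LL' x [/LL' Lx h]].
  exact: szd_sub.
split=> // F eta Ff eta0; have [p [q [Lp Lq hp hq Epq]]] := h F eta Ff eta0.
by exists p, q; split=> //; try exact: LL'; apply: EE' => //; exact: LK.
Qed.

Definition wopen V : Prop := forall x, V x ->
  exists F eta, [/\ finite_set F, 0 < eta & wnbhd F eta x `<=` V].

Lemma wopen_gt (y : X) (c : R) : wopen [set phi | c < `|phi y|].
Proof.
move=> x /= cx; exists [set y], (`|x y| - c); split; [exact: finite_set1|lra|].
move=> a /(_ y erefl) h /=; have := ler_distD (a y) (x y) 0.
by rewrite !subr0 distrC; lra.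
Qed.

Lemma wopen_wnbhd F (eta : R) x : finite_set F -> 0 < eta -> wopen (wnbhd F eta x).
Proof.
move=> /[dup] Ff /finite_fsetP[D FD] eta0 y hy.
have hD : \forall m \near 0^'+, (\bigcap_(p in [set` D]) [set m | m < eta - `|y p - x p|]) m.
  apply: filter_bigI => p pD; apply: nbhs_right_lt.
  by rewrite subr_gt0; apply: hy; rewrite FD.
have [m [m0 hm]] := filter_ex (filterI (nbhs_right_gt (0 : R)) hD).
exists F, m; split=> // a ha p Fp.
have := ha p Fp; move: (Fp); rewrite FD => /hm /=; have := ler_distD (y p) (a p) (x p); lra.
Qed.

(** Pairs close enough to a point of the weak*-open set [V] lie in [V], so at such points the
    derivation only sees the part of [K] inside [V]. *)
Lemma diter_szd_local E K V a : wopen V ->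
  diter (szd E) K a `&` V `<=` diter (szd E) (K `&` V) a.
Proof.
move=> Vo; elim: a => [//|a IH|J f IH] x [] /=; last first.
  by move=> [Kx h] Vx; split=> // i; apply: IH; split.
move=> [xa h] Vx; split=> [|F eta Ff eta0]; first exact: IH.
have [F' [eta' [Ff' eta'0 FV]]] := Vo x Vx.
have m0 : 0 < Num.min eta eta' by rewrite lt_min eta0.
have FF' : finite_set (F `|` F') by rewrite finite_setU.
have [p [q [ap aq hp hq Epq]]] := h _ _ FF' m0.
have near1 r : wnbhd (F `|` F') (Num.min eta eta') x r -> wnbhd F eta x r /\ V r.
  move=> hr; split=> [z Fz|]; first by have := hr z (or_introl Fz); rewrite lt_min => /andP[].
  by apply: FV => z Fz; have := hr z (or_intror Fz); rewrite lt_min => /andP[].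
have [[hp1 Vp] [hq1 Vq]] := (near1 p hp, near1 q hq).
by exists p, q; split=> //; apply: IH.
Qed.

Section Lift.
Variables (T : topologicalType) (f : T -> X -> R).
Hypothesis fc : forall p, continuous (fun l => f l p).

Let fc_near p l (e : R) : 0 < e -> \forall k \near l, `|f k p - f l p| < e.
Proof. by move=> e0; apply: cvgr_distC_lt => //; exact: fc. Qed.

Lemma wnbhd_preimage F (eta : R) l : finite_set F -> 0 < eta ->
  nbhs l [set k | wnbhd F eta (f l) (f k)].
Proof.
move=> /finite_fsetP[D ->] eta0.
have := @filter_bigI _ _ D (fun p => [set k | `|f k p - f l p| < eta]) (nbhs l) _.
by apply=> p _; exact: fc_near.
Qed.

(** Half of [eta] is spent on the closure in [cderiv], half on the related point; the image pair is
    then weak*-close to [f l]. *)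
Lemma diter_cderiv_project (E : T -> T -> Prop) E' (K : set T) K' a :
  (forall l k, K l -> K k -> E l k -> E' (f l) (f k)) ->
  (forall l, K l -> K' (f l)) ->
  forall l, diter (cderiv E) K a l -> diter (szd E') K' a (f l).
Proof.
move=> EE' KK'; apply: diter_transfer => // [L|]; first exact: cderiv_sub.
move=> L L' LK LL' l [Ll cll]; split=> [|F eta Ff eta0]; first exact: LL'.
have eta20 : 0 < eta / 2 by lra.
have [k [[Lk hk] kl]] := cll _ (wnbhd_preimage l Ff eta20).
have [j [Lj jk Ekj]] := hk _ (wnbhd_preimage k Ff eta20).
exists (f k), (f j); split; try exact: LL'.
- by move=> p Fp; have := kl p Fp; lra.
- move=> p Fp; have := ler_distD (f k p) (f j p) (f l p).
  by have := kl p Fp; have := jk p Fp; lra.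
- by apply: EE' => //; exact: LK.
Qed.

Lemma closed_fiber x : closed [set l | f l = x].
Proof.
move=> l cll; apply: funext => p; apply: contrapT => /eqP npx.
have e0 : 0 < `|x p - f l p| by rewrite normr_gt0 subr_eq0 eq_sym.
have nl : nbhs l [set k | `|f k p - f l p| < `|x p - f l p|] := fc_near p l e0.
by have [k [/= -> ]] := cll _ nl; rewrite ltxx.
Qed.

(** Converse of projection, by compactness. One member of each close pair is [E']-related to [x];
    lifts of these members cluster at a point over [x], which survives the derivation upstairs. *)
Lemma diter_szd_lift E E' (G : set T) C a : compact G -> closed G ->
  (forall x y z, E x y -> E' z x \/ E' z y) ->
  C `<=` f @` G ->
  diter (szd E) C a `<=` f @` diter (cderiv (fun l k => E' (f l) (f k))) G a.
Proof.
set D := cderiv _ => Gk Gc EE' CG.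
have Dsub := diter_sub (@cderiv_sub T (fun l k => E' (f l) (f k))).
have Dcl b := closed_diter_cderiv (E := fun l k => E' (f l) (f k)) (a := b) Gc.
elim: a => [//|a IH|J h IH] x /=.
- move=> [_ xa].
  have G'k : compact (diter D G a) by apply: (subclosed_compact _ Gk) => //; exact: Dsub.
  pose B (Fe : set X * R) := [set l | [/\ diter D G a l, wnbhd Fe.1 Fe.2 x (f l) & E' x (f l)]].
  pose FB := filter_from [set Fe : set X * R | finite_set Fe.1 /\ 0 < Fe.2] B.
  have FF : ProperFilter FB.
    apply: filter_from_proper => [|[F e] /= [Ff e0]].
      apply: filter_from_filter => [|[F e] [F' e'] /= [Ff e0] [Ff' e'0]].
        by exists (set0, 1); split=> //=; exact: finite_set0.
      exists (F `|` F', Num.min e e') => /=; first by rewrite finite_setU lt_min e0.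
      move=> l [al wl El]; split; split=> //= p Fp.
        by have := wl p (or_introl Fp); rewrite lt_min => /andP[].
      by have := wl p (or_intror Fp); rewrite lt_min => /andP[].
    have [p [q [/IH[l al <-] /IH[k ak <-] wp wq /EE'-/(_ x)[El|Ek]]]] := xa F e Ff e0.
      by exists l.
    by exists k.
  have [|l [al cll]] := G'k _ FF.
    by exists (set0, 1) => [|l []//]; split=> //=; exact: finite_set0.
  (* The filter forces [f] to converge to [x] pointwise, so the cluster point lies in the fibre over
     [x]. *)
  have flx : f l = x.
    apply: funext => p; apply: contrapT => /eqP npx.
    have e0 : 0 < `|x p - f l p| / 2 by rewrite divr_gt0 // normr_gt0 subr_eq0 eq_sym.
    have FBp : FB (B ([set p], `|x p - f l p| / 2)).
      by exists ([set p], `|x p - f l p| / 2) => //; split=> //=; exact: finite_set1.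
    have nl : nbhs l [set k | `|f k p - f l p| < `|x p - f l p| / 2] := fc_near p l e0.
    have [k [[_ /(_ p erefl) /= k1 _] /= k2]] := cll _ _ FBp nl.
    have := ler_distD (f k p) (x p) (f l p); rewrite (distrC (x p) (f k p)).
    by move: k1 k2; lra.
  exists l => //; split=> //; apply: subset_closure; split=> // V Vl.
  have FB0 : FB (B (set0, 1)) by exists (set0, 1) => //; split=> //=; exact: finite_set0.
  by have [k [[ak _ Ek] Vk]] := cll _ _ FB0 Vl; exists k; rewrite flx.
- move=> [Cx hx]; have [l0 Gl0 l0x] := CG x Cx.
  pose g (o : option J) := if o is Some i then h i else OZ.
  (* The branches may give different lifts of [x]; nested compact fibres provide a common one. *)
  pose H b := diter D G b `&` [set l | f l = x].
  have Hc b : closed (H b) by apply: closedI => //; exact: closed_fiber.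
  have HG b : H b `<=` G by move=> l [/Dsub].
  have Hm b c : ole b c -> H c `<=` H b.
    move=> bc l [lc lx]; split=> //.
    exact: diter_anti (@cderiv_sub _ _) (@cderiv_mono _ _) _ _ _ bc _ lc.
  have Hg o : H (g o) !=set0.
    case: o => [i|]; last by exists l0.
    by have [l li lx] := IH i x (hx i); exists l.
  have [l [Gl hl]] := compact_ole_chain Gk Hc HG Hm None Hg.
  exists l; last by case: (hl None).
  by split=> // i; case: (hl (Some i)).
Qed.

End Lift.
End WeakStarDerivation.

(** * Closedness and compactness of dual balls *)

Section DualSets.
Variables (R : realType) (X : normedModType R).
Implicit Types (S : set X) (r c : R).

(** For a closed subspace [S], the ball of radius [r] in the dual of [X / S], seen inside the dual
    of [X]. *)
Definition dual_set S r : set (X -> R) :=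
  [set phi | [/\ linear_on setT phi, bounded_on setT r phi & forall y, S y -> phi y = 0]].

Lemma dual_set_is_dual S r phi : dual_set S r phi -> is_dual phi.
Proof. by case=> phil phib _; exact: bounded_is_dual phib. Qed.

Section Closed.
Variables (T : topologicalType) (f : T -> X -> R).
Hypothesis fc : forall p, continuous (fun l => f l p).

Let closed_le_cont (g : T -> R) c : continuous g -> closed [set l | g l <= c].
Proof. by move=> gc; apply: (@closed_comp _ _ g [set t | t <= c]) => [l _|]; [exact: gc|exact: closed_le]. Qed.

Let closed_all (A : Type) (Q : A -> T -> Prop) :
  (forall i, closed [set l | Q i l]) -> closed [set l | forall i, Q i l].
Proof.
move=> Qc; rewrite (_ : [set l | _] = \bigcap_(i in [set: A]) [set l | Q i l]).
  by apply: closed_bigI => i _.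
by rewrite predeqE => l; split=> h i *; exact: h.
Qed.

Lemma closed_dist_le (u : X -> R) r : closed [set l | bounded_on setT r (fun x => f l x - u x)].
Proof.
apply: closed_all => x.
rewrite (_ : [set l | _] = [set l | `|f l x - u x| <= r * `|x|]); last first.
  by rewrite predeqE => l; split=> [h|h _]; [exact: h|].
apply: closed_le_cont => l; apply: cvg_norm; apply: cvgB; [exact: fc|exact: cvg_cst].
Qed.

Lemma closed_eval_ge y c : closed [set l | c <= `|f l y|].
Proof.
rewrite (_ : [set l | _] = [set l | - `|f l y| <= - c]); last first.
  by rewrite predeqE => l /=; rewrite lerN2.
by apply: closed_le_cont => l; apply: cvgN; apply: cvg_norm; exact: fc.
Qed.

Lemma closed_dual_set S r : closed [set l | dual_set S r (f l)].
Proof.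
rewrite (_ : [set l | _] = [set l | linear_on setT (f l)] `&`
    [set l | bounded_on setT r (fun x => f l x - 0)] `&` [set l | forall y, S y -> f l y = 0]).
  apply: closedI; first (apply: closedI; last exact: closed_dist_le).
  - apply: closed_all => a; apply: closed_all => x; apply: closed_all => y.
    rewrite (_ : [set l | _] = [set l | `|f l (a *: x + y) - (a * f l x + f l y)| <= 0]).
      apply: closed_le_cont => l; apply: cvg_norm; apply: cvgB; first exact: fc.
      by apply: cvgD; [apply: cvgMr; exact: fc|exact: fc].
    rewrite predeqE => l /=; rewrite normr_le0 subr_eq0; split=> [h|/eqP h _ _ //].
    by apply/eqP; exact: (h I I).
  - apply: closed_all => x; apply: closed_all => _.
    rewrite (_ : [set l | _] = [set l | `|f l x| <= 0]).
      by apply: closed_le_cont => l; apply: cvg_norm; exact: fc.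
    by rewrite predeqE => l /=; rewrite normr_le0; split=> [->|/eqP].
rewrite predeqE => l; split=> [[h1 h2 h3]|[[h1 h2] h3]]; [split=> //; split=> //|split=> //];
  by move=> x _; have := h2 x I; rewrite /= subr0.
Qed.

End Closed.

Local Notation W := (prod_topology (fun _ : X => R)).

Lemma prod_eval_continuous p : continuous (fun phi : W => phi p).
Proof. exact: (@proj_continuous X (fun _ => R) p). Qed.

(** Banach-Alaoglu: a closed subset of a product of segments, which is compact by Tychonoff. *)
Lemma compact_dual_set S r : compact (dual_set S r : set W).
Proof.
apply: (@subclosed_compact _ _ [set phi : W | forall x, `[- (r * `|x|), r * `|x|]%classic (phi x)]).
- exact: (closed_dual_set prod_eval_continuous).
- apply: (@tychonoff X (fun _ => R) (fun x => `[- (r * `|x|), r * `|x|]%classic)) => x.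
  exact: segment_compact.
- by move=> phi [_ phib _] x; rewrite /= in_itv /= -ler_norml; exact: phib.
Qed.

End DualSets.

(** * Composing two quotients and passing to closures of unions *)

Lemma expr_le_eventually (R : realType) (d eps : R) : 0 < d < 1 -> 0 < eps -> exists n, (1 - d) ^+ n <= eps.
Proof.
move=> /andP[d0 d1] e0.
have /cvgrPdist_le/(_ eps e0) : (fun n => (1 - d) ^+ n) @ \oo --> 0.
  by apply: cvg_expr; rewrite ger0_norm; lra.
move=> [n _ /(_ n (leqnn n))] /=; rewrite sub0r normrN => h; exists n.
exact: le_trans (ler_norm _) h.
Qed.

Lemma continuous_addf (R : realType) (T : topologicalType) (g h : T -> R) :
  continuous g -> continuous h -> continuous (fun l => g l + h l).
Proof. by move=> gc hc l; apply: cvgD; [exact: gc|exact: hc]. Qed.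

Lemma continuous_scalef (R : realType) (T : topologicalType) (a : R) (g : T -> R) :
  continuous g -> continuous (fun l => a * g l).
Proof. by move=> gc l; apply: cvgM; [exact: cvg_cst|exact: gc]. Qed.

Section Combination.
Variables (R : realType) (X : normedModType R) (Ix : Type) (J : set Ix).
Variables (Y : Ix -> set X) (P : Ix -> (X -> R) -> (X -> R)).
Implicit Types (phi psi : X -> R) (i j k : Ix).
Hypothesis Ysub : forall i, J i -> closed_subspace (Y i).
Hypothesis Pstar : forall i, J i ->
  (forall phi, is_dual phi -> is_dual (P i phi)) /\
  (forall (a : R) phi psi, is_dual phi -> is_dual psi ->
     P i (fun x => a * phi x + psi x) = (fun x => a * P i phi x + P i psi x)) /\
  (forall phi, is_dual phi -> P i (P i phi) = P i phi) /\
  (forall phi, is_dual phi -> (P i phi = (fun _ => 0) <-> annih (Y i) phi)) /\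
  (forall phi, is_dual phi -> dnorm (P i phi) <= dnorm phi).
Hypothesis Pmodulus : forall eps : R, 0 < eps -> exists delta : R, 0 < delta /\
  forall i, J i -> forall phi, is_dual phi -> dnorm phi = 1 ->
    2 - delta < dnorm (fun x => phi x + P i phi x) ->
    dnorm (fun x => phi x - P i phi x) < eps.

Local Notation W := (prod_topology (fun _ : X => R)).

(* Up to constants, [Sz (S2 / S1) <= mu]: the dual ball of [S2 / S1] consists of the
   restrictions to [S2] of [dual_set S1 1], and [splits S2] measures their distance. *)
Definition szlenk_quot_le (S1 S2 : set X) (mu : Ord) : Prop :=
  forall eps : R, 0 < eps -> diter (szd (splits S2 eps)) (dual_set S1 1) mu = set0.

Lemma subspaceZ i (a : R) x : J i -> Y i x -> Y i (a *: x).
Proof.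
move=> /Ysub[Y0 [Yl _]] Yx; rewrite -[_ *: _]addr0; exact: Yl.
Qed.

Lemma not_bounded_on i (r : R) phi : J i -> is_dual phi -> ~ bounded_on (Y i) r phi ->
  exists y, [/\ Y i y, `|y| <= 1 & r < `|phi y|].
Proof.
move=> Ji phid; apply: contra_notP => h; apply: unit_ball_bounded.
- exact: is_dual_linear.
- by move=> a x; exact: subspaceZ.
- move=> x Yx x1; rewrite leNgt; apply/negP => xr; apply: h; exists x.
  by split.
Qed.

Lemma splits_proj j (eps : R) phi psi x : J j -> 0 <= eps -> is_dual phi -> is_dual psi ->
  `|x| <= 1 -> eps < `|P j phi x - P j psi x| -> splits (Y j) eps phi psi.
Proof.
move=> Jj e0 phid psid x1 hx; have d := is_dual_sub phid psid.
apply: not_bounded_on => // hb.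
have := proj_bounded Ysub Pstar Jj e0 d hb (I : setT x).
rewrite (proj_sub Pstar) // => h.
have : eps * `|x| <= eps by rewrite -[leRHS]mulr1 ler_wpM2l.
by lra.
Qed.

(** Supplies the relation hypothesis of [diter_szd_lift] at the price of a factor two. *)
Lemma splits_halve (S : set X) (eps : R) (a b c : X -> R) :
  splits S eps a b -> splits S (eps / 2) c a \/ splits S (eps / 2) c b.
Proof.
move=> [y [Sy y1 hy]]; have [h|h] := ltP (eps / 2) `|c y - a y|.
  by left; exists y.
right; exists y; split=> //.
by have := ler_distD (c y) (a y) (b y); rewrite (distrC (a y) (c y)); lra.
Qed.

Lemma dual_set_bounded (S1 S2 : set X) (r : R) phi : dual_set S1 r phi -> bounded_on S2 r phi.
Proof. by case=> _ h _ x _; exact: h. Qed.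

Section TwoSteps.
Variables (i j k : Ix) (mu : Ord).
Hypotheses (Jj : J j) (Yij : Y i `<=` Y j).

(** Home of the pairs [(P j phi, phi - P j phi)]: the second entry vanishes on [Y j] and has norm at
    most 2. *)
Let pairs : set (W * W) := dual_set (Y i) 1 `*` dual_set (Y j) 2.

Let psplits (eps : R) (l m : W * W) : Prop :=
  splits (Y j) eps l.1 m.1 \/ splits (Y k) eps l.2 m.2.

Let fst_cont p : continuous (fun l : W * W => l.1 p).
Proof.
move=> l; apply: (@continuous_comp _ _ _ fst (fun phi : W => phi p)).
  exact: cvg_fst.
exact: prod_eval_continuous.
Qed.

Let snd_cont p : continuous (fun l : W * W => l.2 p).
Proof.
move=> l; apply: (@continuous_comp _ _ _ snd (fun phi : W => phi p)).
  exact: cvg_snd.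
exact: prod_eval_continuous.
Qed.

Let pairs_compact : compact pairs.
Proof. by apply: compact_setX; exact: compact_dual_set. Qed.

Let pairs_closed : closed pairs.
Proof.
rewrite (_ : pairs = [set l : W * W | dual_set (Y i) 1 l.1] `&` [set l | dual_set (Y j) 2 l.2]) //.
by apply: closedI; [exact: (closed_dual_set fst_cont)|exact: (closed_dual_set snd_cont)].
Qed.

(** By [diter_cderiv_relU] a surviving pair survives for one coordinate alone, and that coordinate,
    halved in the second case, would survive in a unit dual ball. *)
Let pairs_wpow (eps : R) : 0 < eps ->
  szlenk_quot_le (Y i) (Y j) (wpow mu) -> szlenk_quot_le (Y j) (Y k) (wpow mu) ->
  diter (cderiv (psplits eps)) pairs (wpow mu) = set0.
Proof.
move=> e0 hij hjk; apply/seteqP; split=> // l /diter_cderiv_relU-/(_ pairs_closed)[hl|hl].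
- have := @diter_cderiv_project _ _ _ (fun l : W * W => l.1) fst_cont _
    (splits (Y j) eps) pairs (dual_set (Y i) 1) (wpow mu) _ _ l hl.
  by rewrite hij //; apply=> // m [].
- pose half (l : W * W) : X -> R := fun p => 2^-1 * l.2 p.
  have half_cont p : continuous (fun l : W * W => half l p).
    exact: (continuous_scalef (@snd_cont p)).
  have e20 : 0 < eps / 2 by lra.
  have := @diter_cderiv_project _ _ _ half half_cont _
    (splits (Y k) (eps / 2)) pairs (dual_set (Y j) 1) (wpow mu) _ _ l hl.
  rewrite hjk //; apply=> [m n _ _ [y [Yy y1 hy]]|m [_ [ml mb m0]]].
    exists y; split=> //; rewrite /half -mulrBr normrM gtr0_norm ?invr_gt0 //.
    by rewrite mulrC ltr_pM2l ?invr_gt0.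
  split=> [a x y _ _|x _|y Yy]; rewrite /half.
  + by rewrite ml //; ring.
  + by rewrite normrM gtr0_norm ?invr_gt0 // ler_pdivrMl // mulrA mulr1; exact: mb.
  + by rewrite m0 // mulr0.
Qed.

(* On [C] the map [phi |-> P j phi] is weak*-continuous up to [2 * eps], since limits of
   the [P j phi] lie in [M]; hence the pair [(P j phi, phi - P j phi)] can be followed
   through the derivations. *)
Let local_szlenk (eps : R) nu (C M : set (X -> R)) : 0 < eps ->
  diter (cderiv (psplits eps)) pairs nu = set0 ->
  C `<=` dual_set (Y i) 1 ->
  closed [set l : W * W | M l.1] ->
  (forall phi, C phi -> M (P j phi)) ->
  (forall u, is_dual u -> M u -> bounded_on setT (2 * eps) (fun x => u x - P j u x)) ->
  diter (szd (splits (Y k) (12 * eps))) C nu = set0.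
Proof.
move=> e0 h0 CB Mc CM Mu.
pose f (l : W * W) : X -> R := fun p => l.1 p + l.2 p.
have fc p : continuous (fun l => f l p).
  exact: (continuous_addf (@fst_cont p) (@snd_cont p)).
pose G := pairs `&` [set l | M l.1].
have Gc : closed G by apply: closedI.
have Gk : compact G by apply: (subclosed_compact Gc pairs_compact) => l [].
have EE' (x y z : X -> R) : splits (Y k) (12 * eps) x y ->
    splits (Y k) (6 * eps) z x \/ splits (Y k) (6 * eps) z y.
  by move=> /(@splits_halve _ _ _ _ z); rewrite (_ : 12 * eps / 2 = 6 * eps) //; field.
have CG : C `<=` f @` G.
  move=> phi Cphi; have phiB := CB _ Cphi; have phid := dual_set_is_dual phiB.
  have Pd := proj_dual Pstar Jj phid.
  have Pb : bounded_on setT 1 (P j phi).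
    apply: (proj_bounded Ysub Pstar) => //; exact: dual_set_bounded phiB.
  exists (P j phi, (fun x => phi x - P j phi x) : W); last first.
    by apply: funext => x; rewrite /f /= addrC subrK.
  split; last exact: CM.
  split; split=> /=.
  - exact: is_dual_linear.
  - exact: Pb.
  - move=> y Yy; rewrite (proj_on Pstar) //; last exact: Yij.
    by case: phiB => _ _; exact.
  - exact/is_dual_linear/is_dual_sub.
  - move=> x _; apply: le_trans (ler_normB _ _) _; rewrite mulrDl mul1r.
    by rewrite lerD // -[leRHS]mul1r; [case: phiB => _ h _; exact: h|exact: Pb].
  - by move=> y Yy; rewrite (proj_on Pstar) // subrr.
apply/seteqP; split=> // x /(diter_szd_lift fc Gk Gc EE' CG)[l hl _].
suff : (set0 : set (W * W)) l by [].
rewrite -h0; move: l hl; apply: (diter_transfer (g := id)) => [L||l []//].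
  exact: cderiv_sub.
move=> L L' LG LL' l [/LL' Ll cll]; split=> //.
apply: closure_subset cll => m [Lm hm]; split=> [|V /hm[n [Ln Vn [y [Yy y1 hy]]]]]; first exact: LL'.
exists n; split=> //; first exact: LL'.
have [[[m1 _] Mm] [[n1 _] Mn]] := (LG _ Lm, LG _ Ln).
have m1d := dual_set_is_dual m1; have n1d := dual_set_is_dual n1.
(* The sums differ by more than [6 * eps] at [y]. If the second entries account for at most [eps],
   the first differ by more than [5 * eps], and their projections, each within [2 * eps], by more
   than [eps]. *)
have [h2|h2] := ltP eps `|m.2 y - n.2 y|; first by right; exists y.
left; apply: (splits_proj (x := y)) => //; first exact: ltW.
have near u : is_dual u -> M u -> `|u y - P j u y| <= 2 * eps.
  move=> ud /(Mu _ ud)/(_ y I) h; apply: le_trans h _.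
  by rewrite -[leRHS]mulr1 ler_wpM2l //; lra.
have := near _ m1d Mm; have := near _ n1d Mn.
have := ler_normD (m.1 y - n.1 y) (m.2 y - n.2 y).
have -> : m.1 y - n.1 y + (m.2 y - n.2 y) = f m y - f n y by rewrite /f; ring.
have := ler_distD (P j m.1 y) (m.1 y) (n.1 y).
have := ler_distD (P j n.1 y) (P j m.1 y) (n.1 y).
rewrite (distrC (P j n.1 y) (n.1 y)); move: hy h2; lra.
Qed.

(** If [wpow mu] is one, [P j] is nearly constant near [x] and one derivation suffices. Otherwise
    [diter_cderiv_wpow_eq0] gives an index [nu] whose finite multiples stay below [wpow mu]; each
    block of [nu] derivations descends one geometric layer. *)
Lemma szlenk_quot_le_trans :
  szlenk_quot_le (Y i) (Y j) (wpow mu) -> szlenk_quot_le (Y j) (Y k) (wpow mu) ->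
  szlenk_quot_le (Y i) (Y k) (wpow mu).
Proof.
move=> hij hjk e e0; pose eps := e / 12.
have -> : e = 12 * eps by rewrite /eps; field.
have eps0 : 0 < eps by rewrite /eps; lra.
have h0 := pairs_wpow eps0 hij hjk.
have anti := diter_anti (@szd_sub R X (splits (Y k) (12 * eps))) (@szd_mono R X _).
apply/seteqP; split=> // x xw.
have /(diter_cderiv_wpow_eq0 pairs_compact pairs_closed)[w1|[b [n [hn hb]]]] := h0.
- have h1 : diter (cderiv (psplits eps)) pairs oone = set0.
    rewrite -subset0 => l hl; rewrite -h0; move: hl.
    exact: diter_anti (@cderiv_sub _ _) (@cderiv_mono _ _) _ _ _ w1 _.
  (* The bound for [Y j] over [Y i] leaves nothing after one derivation, so near [x] the ball stays
     within [eps] of [x] on [Y j]. *)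
  have hx : ~ szd (splits (Y j) eps) (dual_set (Y i) 1) x.
    move=> hx; suff : (set0 : set (X -> R)) x by [].
    rewrite -(hij _ eps0).
    exact: diter_anti (@szd_sub _ _ _) (@szd_mono _ _ _) _ _ oone w1 _ hx.
  have [xB _] := anti _ _ _ (oone_le_wpow mu) _ xw.
  have [F [eta [Ff eta0 hF]]] : exists F eta, [/\ finite_set F, 0 < eta & forall a,
      dual_set (Y i) 1 a -> wnbhd F eta x a -> ~ splits (Y j) eps a x].
    apply: contrapT => h; apply: hx; split=> // F eta Ff eta0.
    apply: contrapT => h'; apply: h; exists F, eta; split=> // a aB ha hs.
    apply: h'; exists a, x; split=> // p _; by rewrite subrr normr0.
  have xd := dual_set_is_dual xB.
  (* Since [P j] fixes [P j x], both [u] and [P j u] lie within [eps] of it. *)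
  pose M : set (X -> R) := [set u | bounded_on setT eps (fun z => u z - P j x z)].
  suff : (set0 : set (X -> R)) x by [].
  rewrite -(@local_szlenk eps oone (dual_set (Y i) 1 `&` wnbhd F eta x) M eps0 h1).
  + apply: diter_szd_local; first exact: wopen_wnbhd.
    split; last by move=> p _; rewrite subrr normr0.
    exact: anti (oone_le_wpow mu) _ xw.
  + by move=> a [].
  + exact: (closed_dist_le fst_cont).
  + move=> phi [phiB hphi] z _; have phid := dual_set_is_dual phiB.
    have h : bounded_on (Y j) eps (fun z => phi z - x z).
      apply: contrapT => /(not_bounded_on Jj (is_dual_sub phid xd)).
      exact: hF hphi.
    have := proj_bounded Ysub Pstar Jj (ltW eps0) (is_dual_sub phid xd) h (I : setT z).
    by rewrite (proj_sub Pstar).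
  + move=> u ud Mu z _; have Pxd := proj_dual Pstar Jj xd.
    have uxd := is_dual_sub ud Pxd.
    have := proj_bounded Ysub Pstar Jj (ltW eps0) uxd _ (I : setT z).
    rewrite (proj_sub Pstar) // (proj_proj Pstar Jj Jj _ xd) // => h.
    have := h (fun z _ => Mu z I); have := Mu z I.
    have := ler_distD (P j x z) (u z) (P j u z); rewrite (distrC (P j x z)).
    by rewrite -mulrA; lra.
- have [d d01 hd] := proj_modulus Pstar Pmodulus eps0.
  have [d0 d1] := andP d01.
  pose r m := (1 - d) ^+ m.
  have r0 m : 0 < r m by rewrite /r exprn_gt0 //; lra.
  have r1 m : r m <= 1 by rewrite /r exprn_ile1 //; lra.
  pose K m : set (X -> R) := dual_set (Y i) 1 `&` [set phi | bounded_on (Y j) (r m) phi].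
  pose nu := omul (wpow b) (ofin n).
  pose T L := diter (szd (splits (Y k) (12 * eps))) L nu.
  have KS m : T (K m) `<=` K m.+1.
    move=> phi hphi; have [phiB _] := diter_sub (@szd_sub _ _ _) hphi.
    have phid := dual_set_is_dual phiB.
    split=> //; apply: contrapT => /(not_bounded_on Jj phid)[y [Yy y1 hy]].
    (* Elements of [M] are bounded by [r m] and reach [(1 - d) * r m] at [y], which is what
       [proj_modulus] asks. *)
    pose M : set (X -> R) := [set u | bounded_on setT (r m) (fun x => u x - 0)] `&`
      [set u | r m.+1 <= `|u y|].
    suff : (set0 : set (X -> R)) phi by [].
    rewrite -(@local_szlenk eps nu (K m `&` [set psi | r m.+1 < `|psi y|]) M) //.
    + by apply: diter_szd_local => //; exact: wopen_gt.
    + by move=> a [[]].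
    + apply: (@closedI _ [set l : W * W | bounded_on setT (r m) (fun x => l.1 x - 0)]
        [set l : W * W | r m.+1 <= `|l.1 y|]).
        exact: (closed_dist_le fst_cont).
      exact: (closed_eval_ge fst_cont).
    + move=> psi [[psiB psib] hpsi]; have psid := dual_set_is_dual psiB; split.
        move=> z _ /=; rewrite subr0.
        exact: (proj_bounded Ysub Pstar Jj (ltW (r0 m)) psid psib).
      by rewrite /= (proj_on Pstar) // ltW.
    + move=> u ud [ub uy] z _.
      have ub' : bounded_on setT (r m) u by move=> t tT; have := ub t tT; rewrite subr0.
      have := hd j u y (r m) Jj ud (r0 m) ub' Yy y1; rewrite -exprS => /(_ uy z I).
      move=> h; apply: le_trans h _; apply: ler_wpM2r => //.
      by have := ler_wpM2l (ltW eps0) (r1 m); rewrite mulr1; lra.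
  have KT m : iter m T (K 0%N) `<=` K m.
    elim: m => [//|m IH] phi /= hphi; apply: KS.
    exact: (diter_mono (@szd_mono _ _ _) IH hphi).
  have [N hN] := expr_le_eventually d01 eps0.
  have xK0 : dual_set (Y i) 1 `<=` K 0%N.
    by move=> phi phiB; split=> //; exact: dual_set_bounded phiB.
  suff : (set0 : set (X -> R)) x by [].
  rewrite -(@local_szlenk eps nu (K N) [set u | bounded_on setT eps (fun x => u x - 0)]) //.
  (* [N] blocks reach the layer [K N], where projections have norm at most [eps]; one more block
     empties it. *)
  + have /(_ x xw) := anti (dual_set (Y i) 1) _ _ (hb (N.+1 * n)%N).
    rewrite diter_mul_ofin ?iterM; last exact: szd_sub.
    have -> : iter n (fun L => diter (szd (splits (Y k) (12 * eps))) L (wpow b)) = T.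
      by apply: funext => L; rewrite /T /nu diter_mul_ofin //; exact: szd_sub.
    rewrite iterS => h; apply: (diter_mono (@szd_mono _ _ _) _ h) => phi hphi.
    apply: KT; move: hphi; apply: iter_diter_mono => //; exact: szd_mono.
  + by move=> phi [].
  + exact: (closed_dist_le fst_cont).
  + move=> phi [phiB phib] z _; rewrite /= subr0; have phid := dual_set_is_dual phiB.
    apply: (proj_bounded Ysub Pstar Jj (ltW eps0) phid) => // t Yt.
    by apply: le_trans (phib _ Yt) _; exact: ler_wpM2r.
  + move=> u ud ub z _.
    have ub' : bounded_on setT eps u by move=> t tT; have := ub t tT; rewrite subr0.
    have Pb := proj_bounded Ysub Pstar Jj (ltW eps0) ud (fun t _ => ub' t I).
    apply: le_trans (ler_normB _ _) _; have := ub' z I; have := Pb z I.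
    by rewrite -mulrA; lra.
Qed.

End TwoSteps.
(** A functional above the next layer is large at a point of some [Y j]. Near it, functionals are
    almost determined on [Y k] by their restrictions to [Y j], so [wpow mu] derivations remove it.
    Finitely many layers fit into [wpow (OS mu)]. *)
Lemma szlenk_quot_le_closure i k (Z : set Ix) mu : J k ->
  (forall j, Z j -> [/\ J j, Y j `<=` Y k & szlenk_quot_le (Y i) (Y j) (wpow mu)]) ->
  Y k `<=` closure (\bigcup_(j in Z) Y j) ->
  szlenk_quot_le (Y i) (Y k) (wpow (OS mu)).
Proof.
move=> Jk hZ Yk e e0; pose eps := e / 3.
have -> : e = 3 * eps by rewrite /eps; field.
have eps0 : 0 < eps by rewrite /eps; lra.
have [d d01 hd] := proj_modulus Pstar Pmodulus eps0.
have [d0 d1] := andP d01.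
pose r m := (1 - d) ^+ m.
have r0 m : 0 < r m by rewrite /r exprn_gt0 //; lra.
have r1 m : r m <= 1 by rewrite /r exprn_ile1 //; lra.
pose K m : set (X -> R) := dual_set (Y i) 1 `&` [set phi | bounded_on (Y k) (r m) phi].
pose T L := diter (szd (splits (Y k) (3 * eps))) L (wpow mu).
have KS m : T (K m) `<=` K m.+1.
  move=> phi hphi; have [phiB _] := diter_sub (@szd_sub _ _ _) hphi.
  have phid := dual_set_is_dual phiB.
  split=> //; apply: contrapT => /(not_bounded_on Jk phid)[y [Yy y1 hy]].
  have [j [Zj [z [Yz z1 hz]]]] : exists j, Z j /\ exists z, [/\ Y j z, `|z| <= 1 & r m.+1 < `|phi z|].
    (* Positivity of this expression is an open condition, so it holds at a point of some [Y j];
       [not_bounded_on] then yields one in the unit ball. *)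
    have gc : (fun z => `|phi z| - r m.+1 * `|z|) z @[z --> y] --> `|phi y| - r m.+1 * `|y|.
      apply: cvgB; first by apply: cvg_norm; exact: phid.2.
      by apply: cvgM; [exact: cvg_cst|apply: cvg_norm; exact: cvg_id].
    have g0 : 0 < `|phi y| - r m.+1 * `|y|.
      have : r m.+1 * `|y| <= r m.+1 by rewrite -[leRHS]mulr1 ler_wpM2l // ltW.
      by lra.
    have [z [[j Zj Yz] hz]] := Yk y Yy _ (cvgr_gt _ gc _ g0).
    have [Jj _ _] := hZ j Zj.
    exists j; split=> //; apply: not_bounded_on => // /(_ z Yz).
    by move: hz => /=; lra.
  have [Jj Yjk hj] := hZ j Zj.
  (* [proj_modulus] for [j] is applied to [P k psi], which is bounded by [r m], agrees with [psi] on
     [Y k] and has the same image under [P j]. *)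
  have near psi : K m psi -> r m.+1 < `|psi z| ->
      forall y, Y k y -> `|psi y - P j psi y| <= eps * `|y|.
    move=> [psiB psib] hpsi t Yt; have psid := dual_set_is_dual psiB.
    have ud := proj_dual Pstar Jk psid.
    have ub := proj_bounded Ysub Pstar Jk (ltW (r0 m)) psid psib.
    have := hd j _ z (r m) Jj ud (r0 m) ub Yz z1.
    rewrite -exprS (proj_on Pstar Jk psid (Yjk _ Yz)) => /(_ (ltW hpsi) t I).
    rewrite (proj_on Pstar Jk psid Yt) (proj_proj Pstar Jj Jk Yjk psid) => h.
    apply: le_trans h _; apply: ler_wpM2r => //.
    by have := ler_wpM2l (ltW eps0) (r1 m); rewrite mulr1.
  suff : (set0 : set (X -> R)) phi by [].
  rewrite -(hj _ eps0).
  have : diter (szd (splits (Y k) (3 * eps))) (K m `&` [set psi | r m.+1 < `|psi z|]) (wpow mu) phi.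
    by apply: diter_szd_local => //; exact: wopen_gt.
  (* Passing to [P j a] and [P j b] costs [eps] each, so a gap above [3 * eps] on [Y k] leaves one
     above [eps] on [Y j]. *)
  apply: diter_szd_le => [psi [[]] //|a b [Ka ha] [Kb hb] [x [Yx x1 hx]]].
  have ad : is_dual a by case: Ka => /dual_set_is_dual.
  have bd : is_dual b by case: Kb => /dual_set_is_dual.
  apply: (splits_proj (x := x)) => //; first exact: ltW.
  have := near _ Ka ha _ Yx; have := near _ Kb hb _ Yx.
  have : eps * `|x| <= eps by rewrite -[leRHS]mulr1 ler_wpM2l // ltW.
  have := ler_distD (P j a x) (a x) (b x).
  have := ler_distD (P j b x) (P j a x) (b x).
  by rewrite (distrC (P j b x) (b x)); lra.
have KT m : iter m T (K 0%N) `<=` K m.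
  elim: m => [//|m IH] phi /= hphi; apply: KS.
  exact: (diter_mono (@szd_mono _ _ _) IH hphi).
have [N hN] := expr_le_eventually d01 eps0.
have xK0 : dual_set (Y i) 1 `<=` K 0%N.
  by move=> phi phiB; split=> //; exact: dual_set_bounded phiB.
rewrite -subset0 => x /= [_ /(_ N.+1)].
rewrite diter_mul_ofin => [|L]; last exact: szd_sub.
rewrite iterS -/(T _) => xT.
have {}xT : T (K N) x.
  apply: (diter_mono (@szd_mono _ _ _) _ xT) => phi hphi.
  apply: KT; move: hphi; apply: iter_diter_mono => //; exact: szd_mono.
(* On [Y k] two elements of [K N] differ by at most [2 * eps] on the unit ball, so a single
   derivation empties this layer. *)
have [_ /(_ set0 1 (finite_set0 _) ltr01)] : szd (splits (Y k) (3 * eps)) (K N) x.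
  exact: diter_anti (@szd_sub _ _ _) (@szd_mono _ _ _) _ oone _ (oone_le_wpow mu) _ xT.
move=> [a [b [[_ Ka] [_ Kb] _ _ [y [Yy y1 hy]]]]].
have := ler_normB (a y) (b y); have := Ka y Yy; have := Kb y Yy.
have : r N * `|y| <= eps by rewrite -[leRHS]mulr1 ler_pM // ltW.
by move: hy; lra.
Qed.

End Combination.

(** * Comparison with the Szlenk indices of the space and of the quotients *)

Lemma ole_oaddA a b c : ole (oadd a (oadd b c)) (oadd (oadd a b) c).
Proof.
elim: c => [|c IH|K f IH] /=; first exact: ole_refl.
- exact: ole_S.
- apply: ole_Ll => -[[i|]|].
  + exact: (@ole_Lr _ _ _ (Some i)).
  + by apply: (@ole_Lr _ _ _ None); exact: ole_refl.
  + by apply: (@ole_Lr _ _ _ None); exact: ole_oaddr.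
Qed.

Section BanachSpaceTransfer.
Variables (R : realType) (X : normedModType R).

Lemma Sz_le_of_szlenk_quot_le (mu : Ord) :
  szlenk_quot_le [set 0 : X] setT mu -> Sz_le X mu.
Proof.
move=> h eps eps0; rewrite sz_iter_diter -subset0 => phi; rewrite -(h eps eps0).
apply: (diter_transfer (g := id)) => [L x []//||psi [psid psi1]].
- move=> L L' _ LL' x [/LL' Lx hx]; split=> // F eta Ff eta0.
  have [a [b [La [Lb [ha [hb hab]]]]]] := hx F eta Ff (@subsetT _ _) eta0.
  exists a, b; split=> //; try exact: LL'.
  apply: contrapT => hn; move: hab; apply/negP; rewrite -leNgt.
  apply: ge_sup; first by exists `|a 0 - b 0|; exists 0 => //=; rewrite normr0.
  move=> _ [y /= y1 <-]; rewrite leNgt; apply/negP => hy.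
  by apply: hn; exists y.
- split; first exact: is_dual_linear.
    exact/dnorm_leP.
  by move=> y ->; exact: linear_on0 (is_dual_linear psid).
Qed.

(** Functionals are restricted to [Y1] and extended by zero. The unit ball of [Y1] has quotient norm
    at most one, so a splitting witness bounds [quot_dnorm] from below. *)
Lemma szlenk_quot_le_of_Sz_quot_le (Y1 Y0 : set X) (mu : Ord) :
  Y0 `<=` Y1 -> Y0 0 -> (forall (a : R) x y, Y1 x -> Y1 y -> Y1 (a *: x + y)) ->
  Sz_quot_le Y1 Y0 mu -> szlenk_quot_le Y0 Y1 mu.
Proof.
move=> Y01 Y00 Y1l h eps eps0; rewrite -subset0 => phi hphi.
pose g (phi : X -> R) x : R := if `[< Y1 x >] then phi x else 0.
have gE psi x : Y1 x -> g psi x = psi x by move=> Y1x; rewrite /g asboolT.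
have dist psi y : dual_set Y0 1 psi -> Y1 y -> `|psi y| <= qnorm Y0 y.
  move=> [psil psib psi0] Y1y; apply: lb_le_inf; first by exists `|y - 0|; exists 0.
  move=> _ [z Y0z <-]; have := psib (y - z) I.
  by rewrite linearB_on // (psi0 z) // subr0 mul1r.
suff : (set0 : set (X -> R)) (g phi) by [].
rewrite -(h eps eps0) sz_iter_diter; move: phi hphi.
apply: diter_transfer => [L||psi psiB].
- exact: szd_sub.
- move=> L L' LK LL' x [/LL' Lx hx]; split=> // F eta Ff FY eta0.
  have [a [b [La Lb ha hb [y [Yy y1 hy]]]]] := hx F eta Ff eta0.
  exists (g a), (g b); do 2![split; first exact: LL'].
  split; first by move=> p Fp; rewrite !gE; [exact: ha|exact: FY..].
  split; first by move=> p Fp; rewrite !gE; [exact: hb|exact: FY..].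
  apply: lt_le_trans hy _; apply: ub_le_sup; last first.
    exists y; last by rewrite !gE.
    split=> //; apply: le_trans y1; apply: ge_inf; first by exists 0 => _ [z _ <-].
    by exists 0; rewrite ?subr0.
  exists 2 => _ [z [Y1z z1] <-]; rewrite !gE //.
  apply: le_trans (ler_normB _ _) _.
  have := dist _ z (LK _ La) Y1z; have := dist _ z (LK _ Lb) Y1z; lra.
- have [psil psib psi0] := psiB; split=> [a y z Y1y Y1z|].
    by rewrite !gE //; [exact: psil|exact: Y1l].
  split=> [z Y0z|]; first by rewrite gE ?psi0 //; exact: Y01.
  split=> [x nx|y Y1y]; first by rewrite /g asboolF.
  by rewrite gE //; exact: dist.
Qed.

End BanachSpaceTransfer.

(** * Transfinite induction along the chain of subspaces *)

Section TransfiniteChain.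
Variables (R : realType) (X : normedModType R) (alpha gamma : Ord) (Y : Ord -> set X).
Hypothesis hsub : forall xi, ole xi alpha -> closed_subspace (Y xi).
Hypothesis hwd : forall xi1 xi2, ole xi1 alpha -> ole xi2 alpha ->
  ole xi1 xi2 -> ole xi2 xi1 -> Y xi1 = Y xi2.
Hypothesis hstar : star_condition [set xi | ole xi alpha] Y.
Hypothesis hmono : forall xi1 xi2, olt xi1 xi2 -> ole xi2 alpha -> Y xi1 `<=` Y xi2.
Hypothesis hlim : forall xi, ole xi alpha -> olimit xi ->
  Y xi = closure (\bigcup_(z in [set z | olt z xi]) Y z).
Hypothesis hsz : forall xi, olt xi alpha -> Sz_quot_le (Y (OS xi)) (Y xi) (wpow gamma).

Let olt_ole a b : olt a b -> ole a b.
Proof. exact: (@ole_inv_left (OS a)). Qed.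

Let Ymono a b : ole a b -> ole b alpha -> Y a `<=` Y b.
Proof.
move=> ab ba; have [b_a|] := ole_total b a; last by move=> /hmono; exact.
by rewrite (hwd (ole_trans ab ba) ba ab b_a).
Qed.

Let A (xi eta mu : Ord) := szlenk_quot_le (Y xi) (Y eta) (wpow mu).

Let A_anti xi eta mu nu : ole (wpow mu) (wpow nu) -> A xi eta mu -> A xi eta nu.
Proof.
move=> mn h eps eps0; rewrite -subset0 => phi hphi; rewrite -(h _ eps0).
exact: diter_anti (@szd_sub _ _ _) (@szd_mono _ _ _) _ _ _ mn _ hphi.
Qed.

(** Functionals vanishing on [Y xi] vanish on [Y eta], so nothing splits and the first derivation is
    empty. *)
Let A_refl xi eta mu : Y eta `<=` Y xi -> A xi eta mu.
Proof.
move=> Yle eps eps0; rewrite -subset0 => phi hphi.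
have [_ /(_ set0 1 (finite_set0 _) ltr01)] : szd (splits (Y eta) eps) (dual_set (Y xi) 1) phi.
  exact: diter_anti (@szd_sub _ _ _) (@szd_mono _ _ _) _ oone _ (oone_le_wpow mu) _ hphi.
move=> [a [b [[_ _ a0] [_ _ b0] _ _ [y [/Yle Yy _]]]]].
by rewrite a0 // b0 // subrr normr0; lra.
Qed.

Let A_succ xi : olt xi alpha -> A xi (OS xi) gamma.
Proof.
move=> xa; apply: szlenk_quot_le_of_Sz_quot_le (hsz xa).
- by apply: Ymono => //; apply: ole_Sr; exact: ole_refl.
- by case: (hsub (olt_ole xa)).
- by case: (hsub xa) => _ [].
Qed.

Let A_trans xi eta zeta mu : ole xi eta -> ole eta alpha ->
  A xi eta mu -> A eta zeta mu -> A xi zeta mu.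
Proof.
move=> xe ea; have [P [Pstar Pmod]] := hstar.
exact: (szlenk_quot_le_trans hsub Pstar Pmod ea (Ymono xe ea)).
Qed.

(** At a limit [eta] the closure bound raises the exponent by one; at a successor it suffices to
    compose with the last quotient. *)
Let A_next xi eta mu : ole (wpow gamma) (wpow mu) -> ole xi eta -> ole eta alpha ->
  (forall zeta, ole xi zeta -> olt zeta eta -> A xi zeta mu) -> A xi eta (OS mu).
Proof.
move=> gm xe ea hA; have xa := ole_trans xe ea.
have [ex|xlt] := ole_total eta xi; first by apply: A_refl; exact: Ymono.
have [elim|/existsNP[z /not_implyP[ze nz]]] := pselect (forall z, olt z eta -> olt (OS z) eta).
  have [P [Pstar Pmod]] := hstar.
  apply: (@szlenk_quot_le_closure _ _ _ _ _ _ hsub Pstar Pmod xi eta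
    [set z | ole xi z /\ olt z eta]) => // [z [xz ze]|].
    have ez := olt_ole ze; split; [exact: ole_trans ez ea|exact: Ymono|exact: hA].
  rewrite (hlim ea); last by split=> //; apply: ole_trans xlt; apply: ole_S; exact: ole_Z.
  apply: closure_subset => y [z ze Yzy].
  have [xz|zx] := ole_total xi z; first by exists z.
  exists xi; first by split=> //; exact: ole_refl.
  exact: hmono zx xa _ Yzy.
have [ez|//] := ole_total eta (OS z).
have [xz|zx] := ole_total xi z; last first.
  by apply: A_refl; apply: Ymono => //; exact: ole_trans ez zx.
have za : olt z alpha by exact: ole_trans ze ea.
rewrite /A (hwd ea za ez ze); apply: (@A_anti _ _ mu); first exact: ole_wpow_succ.
apply: (A_trans xz (olt_ole za)); first exact: hA.
exact: A_anti gm (A_succ za).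
Qed.

(** An ordinal below [xi + w * omega] is below some [xi + w * n], and [n] intervals of length [w]
    are joined by [A_trans]. *)
Let A_steps w mu :
  (forall theta zeta, ole theta zeta -> ole zeta alpha -> ole zeta (oadd theta w) ->
     A theta zeta mu) ->
  forall xi eta, ole xi eta -> ole eta alpha ->
    olt eta (oadd xi (omul w oomega)) -> A xi eta mu.
Proof.
move=> hw xi eta xe ea /ole_inv_succ[[n|]] /olt_ole; last first.
  by move=> h; apply: A_refl; apply: Ymono => //; exact: ole_trans xe ea.
elim: n eta xe ea => [|n IH] eta xe ea h.
  by apply: A_refl; apply: Ymono => //; exact: ole_trans xe ea.
have {}h := ole_trans h (ole_oaddA _ _ _).
pose theta := oadd xi (omul w (ofin n)).
have [et|/olt_ole te] := ole_total eta theta; first exact: IH.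
have xt : ole xi theta by exact: ole_oaddr.
apply: (@A_trans _ theta) => //; [exact: ole_trans te ea| |exact: hw].
by apply: IH => //; [exact: ole_trans te ea|exact: ole_refl].
Qed.

(** Induction on [beta]. At a successor, [A_next] includes the right endpoint of an interval of
    length [w^(1+beta)] at the cost of one in the exponent, and [A_steps] joins finitely many such
    intervals at no further cost. *)
Lemma szlenk_quot_le_chain beta xi eta : ole xi eta -> ole eta alpha ->
  olt eta (oadd xi (wpow (oadd oone beta))) ->
  szlenk_quot_le (Y xi) (Y eta) (wpow (oadd gamma beta)).
Proof.
have base : forall xi eta, ole xi eta -> ole eta alpha ->
    olt eta (oadd xi (wpow oone)) -> A xi eta gamma.
  (* Here [w] is one, so [zeta] equals [theta] or its successor. *)
  apply: A_steps => theta zeta tz za zt.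
  have ta := ole_trans tz za.
  have [zlt|tlt] := ole_total zeta theta; first by apply: A_refl; exact: Ymono.
  by rewrite /A (hwd za (ole_trans tlt za) zt tlt); apply: A_succ; exact: ole_trans tlt za.
elim: beta xi eta => [|beta IH|K f IH]; first exact: base.
- apply: A_steps => theta zeta tz za zt.
  apply: A_next => //; first exact: ole_wpow_oaddr.
  move=> z tz' zz; apply: IH => //; first exact: ole_trans (olt_ole zz) za.
  exact: ole_trans zz zt.
- move=> xi eta xe ea /ole_inv_succ h; have xa := ole_trans xe ea.
  (* The first case is a branch of [beta]; the others are the default branches of [oadd oone],
     [wpow] and [oadd xi]. The last two force [eta] to be at most [xi]. *)
  case: h => -[[[i|]|]|] h.
  + apply: (@A_anti _ _ (oadd gamma (f i))); last exact: IH.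
    by apply: (@ole_Lr _ _ _ (Some (Some i))); exact: ole_refl.
  + apply: (@A_anti _ _ gamma); first exact: ole_wpow_oaddr.
    exact: base.
  + by apply: A_refl; apply: Ymono => //; exact: ole_inv_succ h.
  + by apply: A_refl; apply: Ymono => //; exact: olt_ole.
Qed.

End TransfiniteChain.

Unset Implicit Arguments.
Theorem theorem3p12 (R : realType) (X : completeNormedModType R)
  (alpha beta gamma : Ord) (Y : Ord -> set X)
  (hsub : forall xi, ole xi alpha -> closed_subspace (Y xi))
  (hwd : forall xi1 xi2, ole xi1 alpha -> ole xi2 alpha ->
          ole xi1 xi2 -> ole xi2 xi1 -> Y xi1 = Y xi2)
  (hstar : star_condition [set xi | ole xi alpha] Y)
  (hmono : forall xi1 xi2, olt xi1 xi2 -> ole xi2 alpha -> Y xi1 `<=` Y xi2)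
  (h0 : Y OZ = [set 0])
  (halpha : Y alpha = setT)
  (hlim : forall xi, ole xi alpha -> olimit xi ->
          Y xi = closure (\bigcup_(z in [set z | olt z xi]) Y z))
  (hal : olt alpha (wpow (oadd oone beta)))
  (hsz : forall xi, olt xi alpha -> Sz_quot_le (Y (OS xi)) (Y xi) (wpow gamma)) :
  Sz_le X (wpow (oadd gamma beta)).
Proof.
have halpha0 := ole_refl alpha.
apply: Sz_le_of_szlenk_quot_le; rewrite -h0 -halpha.
apply: (szlenk_quot_le_chain hsub hwd hstar hmono hlim hsz (ole_Z _) halpha0).
exact: ole_trans hal (ole_oadd0 _).
Qed.
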